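(* The theory $\mathcal{T_M}^+$ (defined in the context) proves the following mathematical statement. Let $U$ be a map from $X$ to $X$ and $(u_n)_{n\in\mathbb{N}}$ a sequence of elements of $X$ such that $\lim_nd(U(u_n),u_n)=0$. Consider $F:=Fix(U)$. Given $k\in\mathbb{N}$, $\lambda\in\mathbb{R}$ and $\theta:X\to\mathbb{R}$, if $$\forall y\in F\left(\lambda<\theta(y)+\frac{1}{k+1}\right)$$ then, for $n$ sufficiently large, $$\lambda<\theta(u_n)+\frac{1}{k+1}.$$
   Context: **The theory $\mathcal{T_M}$** (bounded metric spaces). Language: finite types over base types $0$ (natural numbers) and $X$ (abstract metric space); $1:=0\to0$; classical many-sorted logic; the only primitive relation is $=_0$. Constants: combinators; zero, successor, recursors for G\''odel's primitive recursive functionals (all types); $d$ of type $X\to(X\to1)$; $b$ of type $0$ (a positive bound on the diameter of $X$). Reals are represented by type-$1$ functionals in signed digit representation: to each $\gamma^1$ is associated primitive recursively (in the sense of Kleene) a representation $\gamma_{\mathbb{R}}$ of a real; $=_{\mathbb{R}},\leq_{\mathbb{R}}$ are $\Pi^0_1$ and $<_{\mathbb{R}}$ is $\Sigma^0_1$. $\gamma_{[0,1]}:=\max_{\mathbb{R}}(0_{\mathbb{R}},\min_{\mathbb{R}}(1_{\mathbb{R}},\gamma_{\mathbb{R}}))$, with a fixed $l^1$ such that $\gamma_{[0,1]}(n)\leq l(n)$ always; $\forall\gamma\in[0,1](\ldots\gamma\ldots)$ stands for $\forall\gamma^1(\ldots\gamma_{[0,1]}\ldots)$, dually for $\exists$.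 $x=_Xy$ abbreviates $d(x,y)=_{\mathbb{R}}0_{\mathbb{R}}$. Axioms: the usual axioms for combinators and arithmetic constants (full induction scheme); Spector's weak (quantifier-free) extensionality rule; $\forall x^X,y^X\forall n^0(d(x,y)(n)=_0d(x,y)_{\mathbb{R}}(n))$; $d(x,x)=_{\mathbb{R}}0_{\mathbb{R}}$; $d(x,y)=_{\mathbb{R}}d(y,x)$; $d(x,z)\leq_{\mathbb{R}}d(x,y)+d(y,z)$; $d(x,y)\leq_{\mathbb{R}}b_{\mathbb{R}}$. **The theory $\mathcal{T_M}^+$.** Bounded formulas are built from atomic formulas by propositional connectives and the bounded quantifications $\forall k\leq_0n$, $\exists k\leq_0n$, $\forall x^X$, $\exists x^X$, $\forall\gamma\in[0,1]$, $\exists\gamma\in[0,1]$. A $\Sigma$-formula has the form $\exists n^0B(n)$ with $B$ bounded. For $f$ of type $1$, $\tilde f(n):=\max_{k\leq n}f(k)$. $\mathcal{T_M}^+$ is $\mathcal{T_M}$ plus, for all $\Sigma$-formulas $A$ (possibly with parameters): bounded choice $\forall n^0\exists k^0A(n,k)\to\exists f^1\forall n\exists k\leq\tilde f(n)A(n,k)$; and bounded collection $\forall i\leq_0m\exists n^0A(i,n)\to\exists n\forall i\leq m\exists k\leq nA(i,k)$, $\forall\gamma\in[0,1]\exists n^0A(\gamma,n)\to\exists n\forall\gamma\in[0,1]\exists k\leq nA(\gamma,k)$, $\forall x^X\exists n^0A(x,n)\to\exists n\forall x^X\exists k\leq nA(x,k)$. The mathematical statement is understood as formalized in this language: $U$ is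 a variable of type $X\to X$, $(u_n)$ of type $0\to X$, $\theta$ of type $X\to1$ (real-valued via representations), $\lambda$ of type $1$; $x\in Fix(U)$ means $U(x)=_Xx$; $\lim_nd(U(u_n),u_n)=0$ means $\forall r\exists n\forall m\geq n\,(d(U(u_m),u_m)\leq\frac{1}{r+1})$; no extensionality or continuity of $U$, $\theta$ is assumed. *)

(* Defs.v *)
From Stdlib Require Import List.
Import ListNotations.

Set Implicit Arguments.

(** * Language

    Finite types over [T0] (the type 0) and [TX] (the type X); terms and formulas are
    intrinsically typed, with de Bruijn variables in a context of types. *)

Inductive ty : Type := T0 | TX | Arr (a b : ty).

Declare Scope obj_scope.
Delimit Scope obj_scope with obj.
Open Scope obj_scope.
Notation "a ~> b" := (Arr a b) (at level 55, right associativity) : obj_scope.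
Notation T1 := (T0 ~> T0).

Definition ctx := list ty.

Inductive var : ctx -> ty -> Type :=
| vz G a : var (a :: G) a
| vs G a b : var G a -> var (b :: G) a.
Arguments vz {G a}.
Arguments vs {G a b} _.

Inductive cst : ty -> Type :=
| Pi a b : cst (a ~> b ~> a)
| Sigma a b c : cst ((a ~> b ~> c) ~> (a ~> b) ~> a ~> c)
| Zero : cst T0
| Succ : cst (T0 ~> T0)
| Rec a : cst (T0 ~> a ~> (a ~> T0 ~> a) ~> a)
| Dist : cst (TX ~> TX ~> T1)
| Bound : cst T0.

Inductive tm (G : ctx) : ty -> Type :=
| Var a : var G a -> tm G a
| Cst a : cst a -> tm G a
| App a b : tm G (a ~> b) -> tm G a -> tm G b.
Arguments Var {G a} _.
Arguments Cst {G a} _.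
Arguments App {G a b} _ _.
Notation "s · t" := (App s t) (at level 39, left associativity) : obj_scope.
Notation v0 := (Var vz).
Notation v1 := (Var (vs vz)).
Notation v2 := (Var (vs (vs vz))).
Notation v3 := (Var (vs (vs (vs vz)))).
Notation v4 := (Var (vs (vs (vs (vs vz))))).
Notation v5 := (Var (vs (vs (vs (vs (vs vz)))))).

Inductive fm (G : ctx) : Type :=
| Bot
| Eq (s t : tm G T0)
| And (A B : fm G)
| Or (A B : fm G)
| Imp (A B : fm G)
| All (a : ty) (A : fm (a :: G))
| Ex (a : ty) (A : fm (a :: G)).
Arguments Bot {G}.
Arguments All {G} a A.
Arguments Ex {G} a A.
Notation "s =0 t" := (Eq s t) (at level 70) : obj_scope.
Notation "A ∧ B" := (And A B) (at level 80, right associativity) : obj_scope.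
Notation "A ∨ B" := (Or A B) (at level 85, right associativity) : obj_scope.
Notation "A ⟶ B" := (Imp A B) (at level 90, right associativity) : obj_scope.

(** * Renaming and substitution *)

Definition ren (G D : ctx) := forall a, var G a -> var D a.
Definition sub (G D : ctx) := forall a, var G a -> tm D a.

Definition scons {G D b} (t : tm D b) (s : sub G D) : sub (b :: G) D :=
  fun a v =>
    match v in var G' a'
      return match G' with
             | [] => unit
             | b' :: G0 => tm D b' -> sub G0 D -> tm D a'
             end
    with
    | vz => fun t _ => t
    | vs w => fun _ s => s _ w
    end t s.

Definition ren_up {G D} b (r : ren G D) : ren (b :: G) (b :: D) :=
  fun a v =>
    match v in var G' a'
      return match G' with
             | [] => unit
             | b' :: G0 => ren G0 D -> var (b' :: D) a'
             end
    with
    | vz => fun _ => vz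
    | vs w => fun r => vs (r _ w)
    end r.

Fixpoint tm_ren {G D} (r : ren G D) {a} (t : tm G a) : tm D a :=
  match t with
  | Var v => Var (r _ v)
  | Cst c => Cst c
  | s · t => tm_ren r s · tm_ren r t
  end.

Fixpoint fm_ren {G D} (r : ren G D) (A : fm G) : fm D :=
  match A with
  | Bot => Bot
  | s =0 t => tm_ren r s =0 tm_ren r t
  | A ∧ B => fm_ren r A ∧ fm_ren r B
  | A ∨ B => fm_ren r A ∨ fm_ren r B
  | A ⟶ B => fm_ren r A ⟶ fm_ren r B
  | All a A => All a (fm_ren (ren_up r) A)
  | Ex a A => Ex a (fm_ren (ren_up r) A)
  end.

Definition shift {G} b : ren G (b :: G) := fun a v => vs v.
Definition tm_wk {G} b {a} (t : tm G a) : tm (b :: G) a := tm_ren (shift b) t.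
Definition fm_wk {G} b (A : fm G) : fm (b :: G) := fm_ren (shift b) A.

Definition sub_up {G D} b (s : sub G D) : sub (b :: G) (b :: D) :=
  scons v0 (fun a v => tm_wk b (s a v)).

Fixpoint tm_sub {G D} (s : sub G D) {a} (t : tm G a) : tm D a :=
  match t with
  | Var v => s _ v
  | Cst c => Cst c
  | t · u => tm_sub s t · tm_sub s u
  end.

Fixpoint fm_sub {G D} (s : sub G D) (A : fm G) : fm D :=
  match A with
  | Bot => Bot
  | t =0 u => tm_sub s t =0 tm_sub s u
  | A ∧ B => fm_sub s A ∧ fm_sub s B
  | A ∨ B => fm_sub s A ∨ fm_sub s B
  | A ⟶ B => fm_sub s A ⟶ fm_sub s B
  | All a A => All a (fm_sub (sub_up s) A)
  | Ex a A => Ex a (fm_sub (sub_up s) A)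
  end.

Definition tm_inst {G a b} (t : tm (a :: G) b) (u : tm G a) : tm G b :=
  tm_sub (scons u (fun _ v => Var v)) t.
Definition fm_inst {G a} (A : fm (a :: G)) (u : tm G a) : fm G :=
  fm_sub (scons u (fun _ v => Var v)) A.

(** * Primitive recursive closed terms *)

(** [strengthen t] is [t] without the variable 0 in its context, if that
    variable does not occur in [t]. *)
Definition strengthen_var {G a b} (v : var (a :: G) b) : option (var G b) :=
  match v in var G' b'
    return match G' with
           | [] => unit
           | _ :: G0 => option (var G0 b')
           end
  with
  | vz => None
  | vs w => Some w
  end.

Fixpoint strengthen {G a b} (t : tm (a :: G) b) : option (tm G b) :=
  match t with
  | Var v => option_map Var (strengthen_var v)
  | Cst c => Some (Cst c)
  | s · t =>
      match strengthen s, strengthen t with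
      | Some s', Some t' => Some (s' · t')
      | _, _ => None
      end
  end.

(** Bracket abstraction: [lam t] is the combinatory term for λx.t, with x the
    variable 0 of [t].  Subterms without x are not decomposed, which keeps the
    terms below small. *)
Definition lam_var {G a b} (v : var (a :: G) b) : tm G (a ~> b) :=
  match v in var G' b'
    return match G' with
           | [] => unit
           | a' :: G0 => tm G0 (a' ~> b')
           end
  with
  | @vz _ c => Cst (Sigma c (c ~> c) c) · Cst (Pi c (c ~> c)) · Cst (Pi c c)
  | vs w => Cst (Pi _ _) · Var w
  end.

Fixpoint lam {G a b} (t : tm (a :: G) b) : tm G (a ~> b) :=
  match t with
  | Var v => lam_var v
  | Cst c => Cst (Pi _ _) · Cst c
  | s · t =>
      match strengthen s, strengthen t with
      | Some s', Some t' => Cst (Pi _ _) · (s' · t')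
      | _, _ => Cst (Sigma _ _ _) · lam s · lam t
      end
  end.

Definition zero {G} : tm G T0 := Cst Zero.
Definition S' {G} (t : tm G T0) : tm G T0 := Cst Succ · t.
Fixpoint numeral {G} (n : nat) : tm G T0 :=
  match n with O => zero | S n => S' (numeral n) end.

Definition rec {G a} (n : tm G T0) (x : tm G a) (f : tm G (a ~> T0 ~> a)) :
  tm G a := Cst (Rec a) · n · x · f.
Notation lam2 t := (lam (lam t)).
Notation lam3 t := (lam (lam2 t)).

Definition plusC {G} : tm G (T0 ~> T0 ~> T0) :=
  lam2 (rec v0 v1 (lam2 (S' v1))).
Definition multC {G} : tm G (T0 ~> T0 ~> T0) :=
  lam2 (rec v0 zero (lam2 (plusC · v1 · v3))).
Definition predC {G} : tm G (T0 ~> T0) :=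
  lam (rec v0 zero (lam2 v0)).
Definition monusC {G} : tm G (T0 ~> T0 ~> T0) :=
  lam2 (rec v0 v1 (lam2 (predC · v1))).

Notation "s ⊕ t" := (plusC · s · t) (at level 50, left associativity) : obj_scope.
Notation "s ⊗ t" := (multC · s · t) (at level 40, left associativity) : obj_scope.
Notation "s ∸ t" := (monusC · s · t) (at level 50, left associativity) : obj_scope.

Definition maxC {G} : tm G (T0 ~> T0 ~> T0) := lam2 (v1 ⊕ (v0 ∸ v1)).
Definition minC {G} : tm G (T0 ~> T0 ~> T0) := lam2 (v1 ∸ (v1 ∸ v0)).
(** [sgC · n] is 0 if [n] is 0, and 1 otherwise. *)
Definition sgC {G} : tm G (T0 ~> T0) := lam (rec v0 zero (lam2 (numeral 1))).
(** [quotC · m · k] is the integer part of m/(k+1): the accumulated quotient q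
    at i is incremented when (k+1)(q+1) ≤ i+1. *)
Definition quotC {G} : tm G (T0 ~> T0 ~> T0) :=
  lam2 (rec v1 zero
    (lam2 (v1 ⊕ sgC · (S' (S' v0) ∸ (S' v2 ⊗ S' v1))))).
Definition pow2C {G} : tm G (T0 ~> T0) :=
  lam (rec v0 (numeral 1) (lam2 (v1 ⊕ v1))).
(** f ↦ f̃, where f̃(n) is the maximum of f(0), …, f(n). *)
Definition runmaxC {G} : tm G (T1 ~> T1) :=
  lam2 (rec v0 (v1 · zero) (lam2 (maxC · v1 · (v3 · S' v0)))).

Notation "s ≤0 t" := (s ∸ t =0 zero) (at level 70) : obj_scope.
Notation "s <0 t" := (S' s ≤0 t) (at level 70) : obj_scope.

(** * Signed digit representation of the reals

    A representation γ consists of an integer part γ(0) − γ(1), followed by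
    digits γ(n+2) ≤ 2, where the entry e stands for the signed digit e − 1.
    It denotes γ(0) − γ(1) + Σ_n (γ(n+2) − 1) 2^-(n+1). *)

(** γ ↦ γ_R: entries larger than 2 in digit positions are replaced by 2. *)
Definition normC {G} : tm G (T1 ~> T1) :=
  lam2 (rec v0 (v1 · zero)
    (lam2 (rec v0 (v3 · numeral 1)
      (lam2 (minC · (v5 · S' (S' v0)) · numeral 2))))).

(** [posC · γ · n − negC · γ · n] is the integer s_n(γ) obtained by truncating
    γ_R after n digits and scaling by 2^n; if x is the real denoted by γ_R,
    then |2^n x − s_n(γ)| ≤ 1. *)
Definition posC {G} : tm G (T1 ~> T1) :=
  lam2 (rec v0 (normC · v1 · zero)
    (lam2 (v1 ⊕ v1 ⊕ normC · v3 · S' (S' v0)))).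
Definition negC {G} : tm G (T1 ~> T1) :=
  lam2 (rec v0 (normC · v1 · numeral 1) (lam2 (S' (v1 ⊕ v1)))).

(** x ≤ y iff s_n(x) ≤ s_n(y) + 2 for all n. *)
Definition le_at {G} (x y : tm G T1) (n : tm G T0) : fm G :=
  posC · x · n ⊕ negC · y · n ≤0 posC · y · n ⊕ negC · x · n ⊕ numeral 2.
Definition lt_at {G} (x y : tm G T1) (n : tm G T0) : fm G :=
  posC · x · n ⊕ negC · y · n ⊕ numeral 2 <0 posC · y · n ⊕ negC · x · n.

Definition leR {G} (x y : tm G T1) : fm G :=
  All T0 (le_at (tm_wk T0 x) (tm_wk T0 y) v0).
Definition eqR {G} (x y : tm G T1) : fm G :=
  All T0 (le_at (tm_wk T0 x) (tm_wk T0 y) v0 ∧ le_at (tm_wk T0 y) (tm_wk T0 x) v0).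
Definition ltR {G} (x y : tm G T1) : fm G :=
  Ex T0 (lt_at (tm_wk T0 x) (tm_wk T0 y) v0).

(** Conversion of approximations into signed digits.  Suppose the integers
    A_m = a(m) − c(m) satisfy |2^m x − A_m| ≤ 2 for all m.  The greedy
    algorithm below maintains an integer s_n = p − q with |2^n x − s_n| ≤ 1:
    s_0 is A_2/4 rounded to a nearest integer, and s_(n+1) = 2 s_n + δ, where
    δ is 1, −1 or 0 according to whether A_(n+3) − 8 s_n is ≥ 2, ≤ −2 or in
    between.  The entry for the digit δ is δ + 1. *)
Definition convdigitC {G} : tm G (T1 ~> T1 ~> T0 ~> T0 ~> T0 ~> T0) :=
  (* λ a c p q n, with left := a(n+3) + 8q and right := c(n+3) + 8p *)
  lam2 (lam3
    (let left := v4 · S' (S' (S' v0)) ⊕ numeral 8 ⊗ v1 in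
     let right := v3 · S' (S' (S' v0)) ⊕ numeral 8 ⊗ v2 in
     (numeral 1 ⊕ sgC · (left ∸ S' right)) ∸ sgC · (right ∸ S' left))).
Definition convpos0C {G} : tm G (T1 ~> T1 ~> T0) :=
  lam2 (quotC · ((v1 · numeral 2 ∸ v0 · numeral 2) ⊕ numeral 2) · numeral 3).
Definition convneg0C {G} : tm G (T1 ~> T1 ~> T0) :=
  lam2 (quotC · ((v0 · numeral 2 ∸ v1 · numeral 2) ⊕ numeral 2) · numeral 3).
Definition convnegC {G} : tm G (T1 ~> T1 ~> T1) :=
  lam3 (rec v0 (convneg0C · v2 · v1) (lam2 (S' (v1 ⊕ v1)))).

Definition convposC {G} : tm G (T1 ~> T1 ~> T1) :=
  lam3 (rec v0 (convpos0C · v2 · v1)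
    (lam2 (v1 ⊕ v1 ⊕
           convdigitC · v4 · v3 · v1 · (convnegC · v4 · v3 · v0) · v0))).
Definition convC {G} : tm G (T1 ~> T1 ~> T1) :=
  lam3 (rec v0 (convpos0C · v2 · v1)
    (lam2 (rec v0 (convneg0C · v4 · v3)
      (lam2 (* context: a c n _ _ _ j *)
        (let a := Var (vs (vs (vs (vs (vs (vs vz)))))) in
         let c := v5 in
         convdigitC · a · c
           · (convposC · a · c · v0) · (convnegC · a · c · v0) · v0))))).

Definition addRC {G} : tm G (T1 ~> T1 ~> T1) :=
  lam2 (convC
    · lam (posC · v2 · v0 ⊕ posC · v1 · v0)
    · lam (negC · v2 · v0 ⊕ negC · v1 · v0)).
Definition maxRC {G} : tm G (T1 ~> T1 ~> T1) :=
  lam2 (convC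
    · lam (maxC · (posC · v2 · v0 ⊕ negC · v1 · v0)
                · (posC · v1 · v0 ⊕ negC · v2 · v0))
    · lam (negC · v2 · v0 ⊕ negC · v1 · v0)).
Definition minRC {G} : tm G (T1 ~> T1 ~> T1) :=
  lam2 (convC
    · lam (minC · (posC · v2 · v0 ⊕ negC · v1 · v0)
                · (posC · v1 · v0 ⊕ negC · v2 · v0))
    · lam (negC · v2 · v0 ⊕ negC · v1 · v0)).

(** The natural number m as a real: integer part m − 0 and zero digits. *)
Definition natRC {G} : tm G (T0 ~> T1) :=
  lam2 (rec v0 v1 (lam2 (sgC · v0))).
(** The real 1/(k+1), by its binary expansion: the n-th binary digit after the
    point is ⌊2^(n+1)/(k+1)⌋ − 2⌊2^n/(k+1)⌋. *)
Definition invRC {G} : tm G (T0 ~> T1) :=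
  lam2 (rec v0 (quotC · numeral 1 · v1)
    (lam2 (rec v0 zero
      (lam2
        (numeral 1 ⊕ quotC · (pow2C · S' v0) · v5
         ∸ numeral 2 ⊗ (quotC · (pow2C · v0) · v5)))))).

Notation "s +R t" := (addRC · s · t) (at level 50, left associativity) : obj_scope.
Notation "s ≤R t" := (leR s t) (at level 70) : obj_scope.
Notation "s <R t" := (ltR s t) (at level 70) : obj_scope.
Notation "s =R t" := (eqR s t) (at level 70) : obj_scope.

(** γ ↦ γ_[0,1].  All values of γ_[0,1] are at most 2. *)
Definition unitC {G} : tm G (T1 ~> T1) :=
  lam (maxRC · (natRC · zero)
             · (minRC · (natRC · numeral 1) · (normC · v0))).

Definition dist {G} (x y : tm G TX) : tm G T1 := Cst Dist · x · y.

(** Equality at all types, defined from =0. *)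
Definition eqX {G} (x y : tm G TX) : fm G := dist x y =R natRC · zero.
Notation "s =TX t" := (eqX s t) (at level 70) : obj_scope.

Fixpoint eqT {G} {a : ty} : tm G a -> tm G a -> fm G :=
  match a with
  | T0 => fun s t => s =0 t
  | TX => fun s t => s =TX t
  | a ~> b => fun s t => All a (eqT (tm_wk a s · v0) (tm_wk a t · v0))
  end.

(** * Bounded formulas *)

Definition AllLe {G} (n : tm G T0) (A : fm (T0 :: G)) : fm G :=
  All T0 (v0 ≤0 tm_wk T0 n ⟶ A).
Definition ExLe {G} (n : tm G T0) (A : fm (T0 :: G)) : fm G :=
  Ex T0 (v0 ≤0 tm_wk T0 n ∧ A).

(** [fm_unit A] is [A] with its variable 0, γ, replaced by γ_[0,1]. *)
Definition fm_unit {G} (A : fm (T1 :: G)) : fm (T1 :: G) :=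
  fm_sub (scons (unitC · v0) (fun _ v => Var (vs v))) A.
Definition All01 {G} (A : fm (T1 :: G)) : fm G := All T1 (fm_unit A).
Definition Ex01 {G} (A : fm (T1 :: G)) : fm G := Ex T1 (fm_unit A).

Inductive qf {G} : fm G -> Prop :=
| qf_bot : qf Bot
| qf_eq s t : qf (s =0 t)
| qf_and A B : qf A -> qf B -> qf (A ∧ B)
| qf_or A B : qf A -> qf B -> qf (A ∨ B)
| qf_imp A B : qf A -> qf B -> qf (A ⟶ B).

Inductive bounded : forall G, fm G -> Prop :=
| bd_bot G : bounded (@Bot G)
| bd_eq G (s t : tm G T0) : bounded (s =0 t)
| bd_and G (A B : fm G) : bounded A -> bounded B -> bounded (A ∧ B)
| bd_or G (A B : fm G) : bounded A -> bounded B -> bounded (A ∨ B)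
| bd_imp G (A B : fm G) : bounded A -> bounded B -> bounded (A ⟶ B)
| bd_allle G n (A : fm (T0 :: G)) : bounded A -> bounded (AllLe n A)
| bd_exle G n (A : fm (T0 :: G)) : bounded A -> bounded (ExLe n A)
| bd_allX G (A : fm (TX :: G)) : bounded A -> bounded (All TX A)
| bd_exX G (A : fm (TX :: G)) : bounded A -> bounded (Ex TX A)
| bd_all01 G (A : fm (T1 :: G)) : bounded A -> bounded (All01 A)
| bd_ex01 G (A : fm (T1 :: G)) : bounded A -> bounded (Ex01 A).

Definition Sigma_fm {G} (A : fm G) : Prop :=
  exists B, bounded B /\ A = Ex T0 B.

(** * Axioms

    Axioms are stated with free variables and arbitrary terms in place of
    universally quantified variables. *)

Definition theory := forall G, fm G -> Prop.

Inductive TM : theory :=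
| ax_refl G (t : tm G T0) : TM (t =0 t)
| ax_leibniz G (s t : tm G T0) (A : fm (T0 :: G)) :
    TM (s =0 t ⟶ fm_inst A s ⟶ fm_inst A t)
| ax_succ_zero G (t : tm G T0) : TM (S' t =0 zero ⟶ Bot)
| ax_succ_inj G (s t : tm G T0) : TM (S' s =0 S' t ⟶ s =0 t)
| ax_induction G (A : fm (T0 :: G)) :
    TM (fm_inst A zero
        ⟶ All T0 (A ⟶ fm_sub (scons (S' v0) (fun _ v => Var (vs v))) A)
        ⟶ All T0 A)
| ax_Pi G a b (s : tm G a) (t : tm G b) : TM (eqT (Cst (Pi a b) · s · t) s)
| ax_Sigma G a b c (r : tm G (a ~> b ~> c)) (s : tm G (a ~> b)) (t : tm G a) :
    TM (eqT (Cst (Sigma a b c) · r · s · t) (r · t · (s · t)))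
| ax_rec_zero G a (x : tm G a) (f : tm G (a ~> T0 ~> a)) :
    TM (eqT (rec zero x f) x)
| ax_rec_succ G a (n : tm G T0) (x : tm G a) (f : tm G (a ~> T0 ~> a)) :
    TM (eqT (rec (S' n) x f) (f · rec n x f · n))
| ax_dist_norm G (x y : tm G TX) (n : tm G T0) :
    TM (dist x y · n =0 normC · dist x y · n)
| ax_dist_refl G (x : tm G TX) : TM (dist x x =R natRC · zero)
| ax_dist_sym G (x y : tm G TX) : TM (dist x y =R dist y x)
| ax_dist_triangle G (x y z : tm G TX) :
    TM (dist x z ≤R dist x y +R dist y z)
| ax_dist_bound G (x y : tm G TX) : TM (dist x y ≤R natRC · Cst Bound).

(** For A(i,n), with n the variable 0 and i the variable 1, the formula
    [skip2 c A] is A read in the context extended by a variable of type [c]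
    just below these two. *)
Definition skip2 {G} a b c (A : fm (b :: a :: G)) : fm (b :: a :: c :: G) :=
  fm_ren (ren_up (ren_up (shift c))) A.
Arguments skip2 {G a b} c A.

Inductive TM_plus : theory :=
| ax_TM G (A : fm G) : TM A -> TM_plus A
| ax_choice G (A : fm (T0 :: T0 :: G)) : Sigma_fm A ->
    TM_plus (All T0 (Ex T0 A)
             ⟶ Ex T1 (All T0 (ExLe (runmaxC · v1 · v0) (skip2 T1 A))))
| ax_collection_N G (m : tm G T0) (A : fm (T0 :: T0 :: G)) : Sigma_fm A ->
    TM_plus (AllLe m (Ex T0 A)
             ⟶ Ex T0 (AllLe (tm_wk T0 m) (ExLe v1 (skip2 T0 A))))
| ax_collection_01 G (A : fm (T0 :: T1 :: G)) : Sigma_fm A ->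
    TM_plus (All01 (Ex T0 A) ⟶ Ex T0 (All01 (ExLe v1 (skip2 T0 A))))
| ax_collection_X G (A : fm (T0 :: TX :: G)) : Sigma_fm A ->
    TM_plus (All TX (Ex T0 A) ⟶ Ex T0 (All TX (ExLe v1 (skip2 T0 A)))).

(** * Derivability

    Classical natural deduction; [proves T H A] says that [A] is derivable in
    the theory [T] from the open assumptions [H], with free variables in the
    context [G].  All sorts are nonempty ([pr_inhabited]).  The premise of the
    quantifier-free extensionality rule has no open assumptions. *)

Inductive proves (T : theory) : forall G, list (fm G) -> fm G -> Prop :=
| pr_axiom G (H : list (fm G)) A : T G A -> proves T H A
| pr_hyp G (H : list (fm G)) A : In A H -> proves T H A
| pr_raa G (H : list (fm G)) A :
    proves T ((A ⟶ Bot) :: H) Bot -> proves T H A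
| pr_andI G (H : list (fm G)) A B :
    proves T H A -> proves T H B -> proves T H (A ∧ B)
| pr_andE1 G (H : list (fm G)) A B : proves T H (A ∧ B) -> proves T H A
| pr_andE2 G (H : list (fm G)) A B : proves T H (A ∧ B) -> proves T H B
| pr_orI1 G (H : list (fm G)) A B : proves T H A -> proves T H (A ∨ B)
| pr_orI2 G (H : list (fm G)) A B : proves T H B -> proves T H (A ∨ B)
| pr_orE G (H : list (fm G)) A B C :
    proves T H (A ∨ B) -> proves T (A :: H) C -> proves T (B :: H) C ->
    proves T H C
| pr_impI G (H : list (fm G)) A B :
    proves T (A :: H) B -> proves T H (A ⟶ B)
| pr_impE G (H : list (fm G)) A B :
    proves T H (A ⟶ B) -> proves T H A -> proves T H B
| pr_allI G (H : list (fm G)) a (A : fm (a :: G)) :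
    proves T (map (fm_wk a) H) A -> proves T H (All a A)
| pr_allE G (H : list (fm G)) a (A : fm (a :: G)) (t : tm G a) :
    proves T H (All a A) -> proves T H (fm_inst A t)
| pr_exI G (H : list (fm G)) a (A : fm (a :: G)) (t : tm G a) :
    proves T H (fm_inst A t) -> proves T H (Ex a A)
| pr_exE G (H : list (fm G)) a (A : fm (a :: G)) C :
    proves T H (Ex a A) ->
    proves T (A :: map (fm_wk a) H) (fm_wk a C) -> proves T H C
| pr_inhabited G (H : list (fm G)) a C :
    proves T (map (fm_wk a) H) (fm_wk a C) -> proves T H C
| pr_ext G (H : list (fm G)) (B : fm G) a b
    (s t : tm G a) (r : tm (a :: G) b) :
    qf B -> proves T [] (B ⟶ eqT s t) ->
    proves T H (B ⟶ eqT (tm_inst r s) (tm_inst r t)).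

Notation "T ⊢ A" := (proves T (@nil (fm nil)) A) (at level 95).

(** lim_n d(U(u_n), u_n) = 0. *)
Definition asymptotically_fixed {G} (U : tm G (TX ~> TX)) (u : tm G (T0 ~> TX)) :
  fm G :=
  (* ∀r ∃n ∀m ≥ n *)
  All T0 (Ex T0 (All T0
    (v1 ≤0 v0 ⟶
     let U := tm_wk T0 (tm_wk T0 (tm_wk T0 U)) in
     let u := tm_wk T0 (tm_wk T0 (tm_wk T0 u)) in
     dist (U · (u · v0)) (u · v0) ≤R invRC · v2))).

Definition in_Fix {G} (U : tm G (TX ~> TX)) (x : tm G TX) : fm G := U · x =TX x.

(* Main.v *)
From Stdlib Require Import List Morphisms Setoid ZArith.
Require Import Defs.
Import ListNotations.

(** By classical logic the hypothesis on fixed points gives, for every x in X, a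
    precision n such that either x fails to look fixed by U up to n digits, or
    n digits witness λ < θ(x) + 1/(k+1).  Bounded collection over X provides one
    N bounding n for all x.  If d(U(u_m), u_m) ≤ 1/(2^N + 1), a bound whose
    first N digits vanish, then u_m looks fixed up to N digits, so it satisfies
    the inequality.

    Looking fixed includes 0 ≤ d(x, y) up to n digits, which is not an axiom: it
    comes from 0 = d(x, x) ≤ d(x, y) + d(y, x), hence from an analysis of the
    conversion algorithm behind the addition of signed digit reals. *)

Set Implicit Arguments.

(** * Substitution and bracket abstraction *)

(** No continuity or extensionality of U and θ is available, so nothing can be transferred from a
    fixed point to a nearby point. The collected statement therefore speaks of arbitrary x and is
    instantiated at u_m itself. Collection only supplies some precision n ≤ N that depends on u_m,
    and the finite-precision statement is an implication, which need not pass from n to N. Hence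
    closeness to 0 is established at every precision up to N, and this is what the exponent in 2^N
    provides.

    All reasoning happens inside the object theory, where even commutativity of addition must be
    derived from the recursor equations. Rewriting with a contextual equality and certificates for
    linear inequalities keep these derivations short. For addition of reals only an upper estimate
    of the truncations of x + y enters, because the sum stands on the right of the triangle
    inequality. *)

Lemma var_case G b (P : forall a, var (b :: G) a -> Prop) :
  P b vz -> (forall a (w : var G a), P a (vs w)) ->
  forall a (v : var (b :: G) a), P a v.
Proof.
intros P0 PS a v.
(* The index [b :: G] is generalized to [G'], and the motive is trivial for empty [G']; thus no
   equality between contexts has to be inverted. *)
exact (match v as v' in var G' a' return
         match G' return var G' a' -> Prop with
         | [] => fun _ => True
         | b' :: G0 => fun v' => forall Q : forall a, var (b' :: G0) a -> Prop,
             Q b' vz -> (forall a w, Q a (vs w)) -> Q a' v'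
         end v' with
       | vz => fun Q Q0 QS => Q0
       | vs w => fun Q Q0 QS => QS _ w
       end P P0 PS).
Qed.

Definition ids {G} : sub G G := fun _ v => Var v.
Definition tail_sub {G b} : sub G (b :: G) := fun _ v => Var (vs v).

Lemma tm_sub_ext G D (s s' : sub G D) a (t : tm G a) :
  (forall a v, s a v = s' a v) -> tm_sub s t = tm_sub s' t.
Proof.
intros E; induction t; cbn; [apply E|reflexivity|now rewrite IHt1, IHt2].
Qed.

Lemma tm_ren_sub G D (r : ren G D) a (t : tm G a) :
  tm_ren r t = tm_sub (fun _ v => Var (r _ v)) t.
Proof. induction t; cbn; [reflexivity|reflexivity|now rewrite IHt1, IHt2]. Qed.

Lemma tm_sub_sub G D E (s : sub G D) (s' : sub D E) a (t : tm G a) :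
  tm_sub s' (tm_sub s t) = tm_sub (fun _ v => tm_sub s' (s _ v)) t.
Proof. induction t; cbn; [reflexivity|reflexivity|now rewrite IHt1, IHt2]. Qed.

Lemma tm_sub_ids G a (t : tm G a) : tm_sub ids t = t.
Proof. induction t; cbn; [reflexivity|reflexivity|now rewrite IHt1, IHt2]. Qed.

Lemma tm_sub_wk G D b (s : sub (b :: G) D) a (t : tm G a) :
  tm_sub s (tm_wk b t) = tm_sub (fun _ v => s _ (vs v)) t.
Proof. unfold tm_wk; rewrite tm_ren_sub, tm_sub_sub; reflexivity. Qed.

Lemma tm_sub_scons_wk G D b (u : tm D b) (s : sub G D) a (t : tm G a) :
  tm_sub (scons u s) (tm_wk b t) = tm_sub s t.
Proof. rewrite tm_sub_wk; reflexivity. Qed.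

Lemma tm_inst_wk G b (u : tm G b) a (t : tm G a) :
  tm_sub (scons u (fun _ v => Var v)) (tm_wk b t) = t.
Proof. rewrite tm_sub_scons_wk; apply tm_sub_ids. Qed.

Lemma tm_sub_tail G b a (t : tm G a) : tm_sub tail_sub t = tm_wk b t.
Proof. unfold tm_wk; rewrite tm_ren_sub; reflexivity. Qed.

Lemma tm_sub_up_scons G D E b (s : sub G D) (s' : sub D E) (u : tm E b)
    a (t : tm (b :: G) a) :
  tm_sub (scons u s') (tm_sub (sub_up s) t) =
  tm_sub (scons u (fun _ v => tm_sub s' (s _ v))) t.
Proof.
rewrite tm_sub_sub; apply tm_sub_ext.
apply (var_case (fun a v => tm_sub (scons u s') (sub_up s v) =
  scons u (fun _ v => tm_sub s' (s _ v)) v)); cbn; [reflexivity|].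
intros; apply tm_sub_scons_wk.
Qed.

Lemma strengthen_wk G a b (t : tm G b) : strengthen (tm_wk a t) = Some t.
Proof.
induction t; cbn; try reflexivity.
unfold tm_wk in *; rewrite IHt1, IHt2; reflexivity.
Qed.

Lemma strengthen_var_Some G a b (v : var (a :: G) b) w :
  strengthen_var v = Some w -> v = vs w.
Proof.
revert w; revert b v.
refine (var_case (fun b v => forall w, strengthen_var v = Some w -> v = vs w) _ _);
  cbn; congruence.
Qed.

Lemma strengthen_Some G a b (t : tm (a :: G) b) t' :
  strengthen t = Some t' -> t = tm_wk a t'.
Proof.
revert t'.
induction t as [b v|b c|b c s IHs t IHt]; cbn; intros t'.
- destruct (strengthen_var v) eqn:E; cbn; intros [= <-].
  now rewrite (strengthen_var_Some v E).
- now intros [= <-].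
- destruct (strengthen s) as [s'|]; [|easy].
  destruct (strengthen t) as [u|]; [|easy].
  intros [= <-].
  rewrite (IHs _ eq_refl), (IHt _ eq_refl); reflexivity.
Qed.

(** [sub_up s] fixes variable 0 and sends the other variables to weakened terms, where variable 0
    does not occur. Consequently [lam] takes the same branch before and after a substitution. *)
Lemma strengthen_sub G D a (s : sub G D) b (t : tm (a :: G) b) :
  strengthen (tm_sub (sub_up s) t) = option_map (tm_sub s) (strengthen t).
Proof.
induction t as [b v|b c|b c t IHt u IHu]; cbn.
- revert b v; apply var_case; cbn; [reflexivity|].
  intros; apply strengthen_wk.
- reflexivity.
- rewrite IHt, IHu.
  destruct (strengthen t), (strengthen u); reflexivity.
Qed.

Lemma lam_wk G a b (t : tm G b) : lam (tm_wk a t) = Cst (Pi b a) · t.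
Proof.
destruct t; cbn; [reflexivity|reflexivity|].
change (tm_ren (shift a) ?t) with (tm_wk a t).
now rewrite !strengthen_wk.
Qed.

(** A syntactic identity, which relies on [lam] leaving subterms without variable 0 whole. If it
    decomposed them, substituting an application for a variable would change the shape of the
    abstraction. *)
Lemma lam_sub G D a (s : sub G D) b (t : tm (a :: G) b) :
  tm_sub s (lam t) = lam (tm_sub (sub_up s) t).
Proof.
induction t as [b v|b c|b c t IHt u IHu].
- revert b v; apply var_case; cbn; [reflexivity|].
  intros; now rewrite lam_wk.
- reflexivity.
- cbn; rewrite !strengthen_sub.
  destruct (strengthen t), (strengthen u); cbn; congruence.
Qed.

(** * Weakening and contextual equality *)

Notation "H ⊩ A" := (proves TM_plus H A) (at level 95).

Lemma weaken T G (H H' : list (fm G)) A :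
  proves T H A -> incl H H' -> proves T H' A.
Proof.
intros D; revert H'.
assert (C : forall G (A : fm G) H H', incl H H' -> incl (A :: H) (A :: H'))
  by (intros ? ? ? ? I x [<-|?]; [now left|right; auto]).
assert (M : forall G b (H H' : list (fm G)), incl H H' ->
  incl (map (fm_wk b) H) (map (fm_wk b) H')) by (intros; now apply incl_map).
induction D; intros H' I.
- now apply pr_axiom.
- now apply pr_hyp, I.
- apply pr_raa; auto.
- apply pr_andI; auto.
- apply (pr_andE1 (B := B)); auto.
- apply (pr_andE2 (A := A)); auto.
- apply pr_orI1; auto.
- apply pr_orI2; auto.
- apply (pr_orE (A := A) (B := B)); auto.
- apply pr_impI; auto.
- apply (pr_impE (A := A)); auto.
- apply pr_allI; auto.
- apply pr_allE; auto.
- apply (pr_exI _ t); auto.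
- apply (pr_exE (A := A)); auto.
- apply (@pr_inhabited T _ H' a); auto.
- now apply pr_ext.
Qed.

Lemma weaken1 G (H : list (fm G)) A B : H ⊩ A -> B :: H ⊩ A.
Proof. intros D; apply (weaken D); intros x; now right. Qed.

Lemma pr_head G (H : list (fm G)) A : A :: H ⊩ A.
Proof. apply pr_hyp; now left. Qed.

Lemma pr_exfalso G (H : list (fm G)) A : H ⊩ Bot -> H ⊩ A.
Proof. intros D; apply pr_raa, weaken1, D. Qed.

(** Equality of [s] and [t] in every context of type 0; unlike [eqT], it is a
    congruence at all types. *)
Definition heq {G} (H : list (fm G)) {a} (s t : tm G a) : Prop :=
  forall r : tm (a :: G) T0, H ⊩ tm_inst r s =0 tm_inst r t.

Lemma pr_refl G (H : list (fm G)) t : H ⊩ t =0 t.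
Proof. apply pr_axiom, ax_TM, ax_refl. Qed.

Lemma pr_leibniz G (H : list (fm G)) (A : fm (T0 :: G)) s t :
  H ⊩ s =0 t -> H ⊩ fm_inst A s -> H ⊩ fm_inst A t.
Proof.
intros D; apply pr_impE; refine (pr_impE _ D); apply pr_axiom, ax_TM, ax_leibniz.
Qed.

(** This is the extensionality rule with the trivial antecedent [zero =0 zero]. The premise of the
    rule has no open assumptions, so the equation must be a theorem; the conclusion then holds under
    every [H]. *)
Lemma heq_of_eqT G (H : list (fm G)) a (s t : tm G a) :
  [] ⊩ eqT s t -> heq H s t.
Proof.
intros D r.
refine (pr_impE (A := zero =0 zero) _ (pr_refl _ _)).
refine (@pr_ext _ _ H (zero =0 zero) a T0 s t r _ _); [constructor|].
apply pr_impI, weaken1, D.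
Qed.

(** At type 0 the Leibniz axiom takes the place of the extensionality rule, so the equation may
    depend on open assumptions. *)
Lemma heq_of_eq G (H : list (fm G)) s t : H ⊩ s =0 t -> heq H s t.
Proof.
intros D r.
pose proof (@pr_leibniz G H (tm_wk T0 (tm_inst r s) =0 r) s t D) as L.
unfold fm_inst in L; cbn [fm_sub] in L.
rewrite !tm_inst_wk in L.
apply L, pr_refl.
Qed.

Lemma eq_of_heq G (H : list (fm G)) (s t : tm G T0) : heq H s t -> H ⊩ s =0 t.
Proof. intros E; exact (E v0). Qed.

Lemma heq_weaken G (H H' : list (fm G)) a (s t : tm G a) :
  heq H s t -> incl H H' -> heq H' s t.
Proof. intros E I r; exact (weaken (E r) I). Qed.

Lemma heq_refl G (H : list (fm G)) a : Reflexive (heq H (a := a)).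
Proof. intros t r; apply pr_refl. Qed.

Lemma heq_sym G (H : list (fm G)) a : Symmetric (heq H (a := a)).
Proof.
intros s t E r.
pose proof (@pr_leibniz G H (v0 =0 tm_wk T0 (tm_inst r s)) _ _ (E r)) as L.
unfold fm_inst in L; cbn [fm_sub tm_sub scons] in L.
rewrite !tm_inst_wk in L.
apply L, pr_refl.
Qed.

Lemma heq_trans G (H : list (fm G)) a : Transitive (heq H (a := a)).
Proof.
intros s t u E F r.
pose proof (@pr_leibniz G H (tm_wk T0 (tm_inst r s) =0 v0) _ _ (F r)) as L.
unfold fm_inst in L; cbn [fm_sub tm_sub scons] in L.
rewrite !tm_inst_wk in L.
apply L, E.
Qed.

Instance heq_equiv G (H : list (fm G)) a : Equivalence (heq H (a := a)).
Proof. split; [apply heq_refl|apply heq_sym|apply heq_trans]. Qed.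

Lemma heq_inst G (H : list (fm G)) a b (r : tm (a :: G) b) (s t : tm G a) :
  heq H s t -> heq H (tm_inst r s) (tm_inst r t).
Proof.
intros E q.
assert (C : forall u, tm_inst q (tm_inst r u) = tm_inst (tm_sub (scons r tail_sub) q) u).
{ intros u; unfold tm_inst; rewrite tm_sub_sub; apply tm_sub_ext.
  apply var_case; reflexivity. }
rewrite !C; apply E.
Qed.

Instance App_heq G (H : list (fm G)) a b :
  Proper (heq H ==> heq H ==> heq H) (@App G a b).
Proof.
intros f g E x y F; transitivity (g · x).
- pose proof (heq_inst (v0 · tm_wk _ x) E) as L.
  unfold tm_inst in L; cbn in L; now rewrite !tm_inst_wk in L.
- pose proof (heq_inst (tm_wk _ g · v0) F) as L.
  unfold tm_inst in L; cbn in L; now rewrite !tm_inst_wk in L.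
Qed.

Lemma Pi_heq G (H : list (fm G)) a b (s : tm G a) (t : tm G b) :
  heq H (Cst (Pi a b) · s · t) s.
Proof. apply heq_of_eqT, pr_axiom, ax_TM, ax_Pi. Qed.

Lemma Sigma_heq G (H : list (fm G)) a b c (r : tm G (a ~> b ~> c)) s t :
  heq H (Cst (Sigma a b c) · r · s · t) (r · t · (s · t)).
Proof. apply heq_of_eqT, pr_axiom, ax_TM, ax_Sigma. Qed.

Lemma rec_zero G (H : list (fm G)) a (x : tm G a) f : heq H (rec zero x f) x.
Proof. apply heq_of_eqT, pr_axiom, ax_TM, ax_rec_zero. Qed.

Lemma rec_succ G (H : list (fm G)) a n (x : tm G a) f :
  heq H (rec (S' n) x f) (f · rec n x f · n).
Proof. apply heq_of_eqT, pr_axiom, ax_TM, ax_rec_succ. Qed.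

Lemma beta G (H : list (fm G)) a b (t : tm (a :: G) b) (u : tm G a) :
  heq H (lam t · u) (tm_inst t u).
Proof.
induction t as [b v|b c|b c s IHs t IHt].
- revert b v; apply var_case; cbn.
  + rewrite Sigma_heq; apply Pi_heq.
  + intros; apply Pi_heq.
- apply Pi_heq.
- cbn.
  assert (C : heq H (Cst (Sigma _ _ _) · lam s · lam t · u) (tm_inst (s · t) u))
    by (rewrite Sigma_heq, IHs, IHt; reflexivity).
  destruct (strengthen s) as [s'|] eqn:Es; [|exact C].
  destruct (strengthen t) as [t'|] eqn:Et; [|exact C].
  rewrite (strengthen_Some _ Es), (strengthen_Some _ Et).
  rewrite !tm_inst_wk; apply Pi_heq.
Qed.

Lemma beta_sub G D (H : list (fm D)) (s : sub G D) a b (t : tm (a :: G) b) u :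
  heq H (tm_sub s (lam t) · u) (tm_sub (scons u s) t).
Proof.
rewrite lam_sub, beta; unfold tm_inst; rewrite tm_sub_up_scons.
erewrite tm_sub_ext; [reflexivity|].
apply var_case; cbn; [reflexivity|]; intros; apply tm_sub_ids.
Qed.

Lemma beta2_sub G D (H : list (fm D)) (s : sub G D) a b c
    (t : tm (b :: a :: G) c) u w :
  heq H (tm_sub s (lam2 t) · u · w) (tm_sub (scons w (scons u s)) t).
Proof. rewrite beta_sub; apply beta_sub. Qed.

Lemma beta3_sub G D (H : list (fm D)) (s : sub G D) a b c d
    (t : tm (c :: b :: a :: G) d) u w x :
  heq H (tm_sub s (lam3 t) · u · w · x)
    (tm_sub (scons x (scons w (scons u s))) t).
Proof. rewrite beta2_sub; apply beta_sub. Qed.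

(** * Computation of the combinatory terms *)

Lemma numeral_sub G D (s : sub G D) n : tm_sub s (numeral n) = numeral n.
Proof. induction n; cbn; [reflexivity|now rewrite IHn]. Qed.
Lemma plusC_sub G D (s : sub G D) : tm_sub s plusC = plusC.
Proof. reflexivity. Qed.
Lemma multC_sub G D (s : sub G D) : tm_sub s multC = multC.
Proof. reflexivity. Qed.
Lemma predC_sub G D (s : sub G D) : tm_sub s predC = predC.
Proof. reflexivity. Qed.
Lemma monusC_sub G D (s : sub G D) : tm_sub s monusC = monusC.
Proof. reflexivity. Qed.
Lemma minC_sub G D (s : sub G D) : tm_sub s minC = minC.
Proof. reflexivity. Qed.
Lemma sgC_sub G D (s : sub G D) : tm_sub s sgC = sgC.
Proof. reflexivity. Qed.
Lemma quotC_sub G D (s : sub G D) : tm_sub s quotC = quotC.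
Proof. reflexivity. Qed.
Lemma pow2C_sub G D (s : sub G D) : tm_sub s pow2C = pow2C.
Proof. reflexivity. Qed.
Lemma normC_sub G D (s : sub G D) : tm_sub s normC = normC.
Proof. reflexivity. Qed.
Lemma posC_sub G D (s : sub G D) : tm_sub s posC = posC.
Proof. reflexivity. Qed.
Lemma negC_sub G D (s : sub G D) : tm_sub s negC = negC.
Proof. reflexivity. Qed.
Lemma convdigitC_sub G D (s : sub G D) : tm_sub s convdigitC = convdigitC.
Proof. reflexivity. Qed.
Lemma convpos0C_sub G D (s : sub G D) : tm_sub s convpos0C = convpos0C.
Proof. reflexivity. Qed.
Lemma convneg0C_sub G D (s : sub G D) : tm_sub s convneg0C = convneg0C.
Proof. reflexivity. Qed.
Lemma convnegC_sub G D (s : sub G D) : tm_sub s convnegC = convnegC.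
Proof. reflexivity. Qed.
Lemma convposC_sub G D (s : sub G D) : tm_sub s convposC = convposC.
Proof. reflexivity. Qed.
Lemma convC_sub G D (s : sub G D) : tm_sub s convC = convC.
Proof. reflexivity. Qed.
Lemma addRC_sub G D (s : sub G D) : tm_sub s addRC = addRC.
Proof. reflexivity. Qed.
Lemma natRC_sub G D (s : sub G D) : tm_sub s natRC = natRC.
Proof. reflexivity. Qed.
Lemma invRC_sub G D (s : sub G D) : tm_sub s invRC = invRC.
Proof. reflexivity. Qed.

Lemma App_sub G D (s : sub G D) a b (f : tm G (a ~> b)) x :
  tm_sub s (f · x) = tm_sub s f · tm_sub s x.
Proof. reflexivity. Qed.
Lemma S'_sub G D (s : sub G D) x : tm_sub s (S' x) = S' (tm_sub s x).
Proof. reflexivity. Qed.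
Lemma zero_sub G D (s : sub G D) : tm_sub s zero = zero.
Proof. reflexivity. Qed.
Lemma rec_sub G D (s : sub G D) a n (x : tm G a) f :
  tm_sub s (rec n x f) = rec (tm_sub s n) (tm_sub s x) (tm_sub s f).
Proof. reflexivity. Qed.
Lemma vz_sub G D (s : sub G D) b (u : tm D b) : tm_sub (scons u s) v0 = u.
Proof. reflexivity. Qed.
Lemma vs_sub G D (s : sub G D) b (u : tm D b) a (v : var G a) :
  tm_sub (scons u s) (Var (vs v)) = tm_sub s (Var v).
Proof. reflexivity. Qed.

Instance S'_heq G (H : list (fm G)) :
  Proper (heq H ==> heq H) (@S' G).
Proof. intros x y E; unfold S'; now rewrite E. Qed.

(** Keeps unification from expanding the combinatory terms. *)
Opaque lam S' zero numeral rec.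

Ltac sub_simpl :=
  repeat match goal with
  | |- context [tm_sub ids ?t] => rewrite (tm_sub_ids t)
  | |- context [tm_sub (@tail_sub _ ?b) ?t] => rewrite (tm_sub_tail b t)
  | |- context [tm_sub (scons ?u ?s) (tm_wk _ ?t)] =>
      rewrite (tm_sub_scons_wk u s t)
  | |- context [tm_sub (scons ?u ?s) (Var vz)] => rewrite (vz_sub s u)
  | |- context [tm_sub (scons ?u ?s) (Var (vs ?v))] => rewrite (vs_sub s u v)
  | |- context [tm_sub ?s (?f · ?x)] => rewrite (App_sub s f x)
  | |- context [tm_sub ?s (S' ?x)] => rewrite (S'_sub s x)
  | |- context [tm_sub ?s zero] => rewrite (zero_sub s)
  | |- context [tm_sub ?s (numeral ?n)] => rewrite (numeral_sub s n)
  | |- context [tm_sub ?s (rec ?n ?x ?f)] => rewrite (rec_sub s n x f)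
  | |- context [tm_sub ?s plusC] => rewrite (plusC_sub s)
  | |- context [tm_sub ?s multC] => rewrite (multC_sub s)
  | |- context [tm_sub ?s predC] => rewrite (predC_sub s)
  | |- context [tm_sub ?s monusC] => rewrite (monusC_sub s)
  | |- context [tm_sub ?s minC] => rewrite (minC_sub s)
  | |- context [tm_sub ?s sgC] => rewrite (sgC_sub s)
  | |- context [tm_sub ?s quotC] => rewrite (quotC_sub s)
  | |- context [tm_sub ?s pow2C] => rewrite (pow2C_sub s)
  | |- context [tm_sub ?s normC] => rewrite (normC_sub s)
  | |- context [tm_sub ?s posC] => rewrite (posC_sub s)
  | |- context [tm_sub ?s negC] => rewrite (negC_sub s)
  | |- context [tm_sub ?s convdigitC] => rewrite (convdigitC_sub s)
  | |- context [tm_sub ?s convpos0C] => rewrite (convpos0C_sub s)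
  | |- context [tm_sub ?s convneg0C] => rewrite (convneg0C_sub s)
  | |- context [tm_sub ?s convnegC] => rewrite (convnegC_sub s)
  | |- context [tm_sub ?s convposC] => rewrite (convposC_sub s)
  | |- context [tm_sub ?s convC] => rewrite (convC_sub s)
  | |- context [tm_sub ?s addRC] => rewrite (addRC_sub s)
  | |- context [tm_sub ?s natRC] => rewrite (natRC_sub s)
  | |- context [tm_sub ?s invRC] => rewrite (invRC_sub s)
  end.

Lemma beta1 G (H : list (fm G)) a b (t : tm (a :: G) b) u :
  heq H (lam t · u) (tm_sub (scons u ids) t).
Proof. apply beta. Qed.

Lemma beta2 G (H : list (fm G)) a b c (t : tm (b :: a :: G) c) u w :
  heq H (lam2 t · u · w) (tm_sub (scons w (scons u ids)) t).
Proof. rewrite <- (tm_sub_ids (lam2 t)); apply beta2_sub. Qed.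

Lemma beta3 G (H : list (fm G)) a b c d (t : tm (c :: b :: a :: G) d) u w x :
  heq H (lam3 t · u · w · x) (tm_sub (scons x (scons w (scons u ids))) t).
Proof. rewrite <- (tm_sub_ids (lam3 t)); apply beta3_sub. Qed.

Section Recursion.
Variables (G : ctx) (H : list (fm G)).
Notation "s == t" := (heq H s t) (at level 70).

Lemma plus_0 x : x ⊕ zero == x.
Proof. unfold plusC at 1; rewrite beta2; sub_simpl; apply rec_zero. Qed.

Lemma plus_S x y : x ⊕ S' y == S' (x ⊕ y).
Proof.
(* The step function does not mention the recursion argument, so [S' y] may stand in its closure
   instead of [y]. Written this way it is the step function that appears when [x ⊕ S' y] is
   unfolded. The later successor equations use the same device. *)
assert (E : x ⊕ y == rec y x
  (tm_sub (scons (S' y) (scons x ids)) (lam2 (S' v1))))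
  by (unfold plusC; rewrite beta2; sub_simpl; reflexivity).
rewrite E.
unfold plusC; rewrite beta2; sub_simpl.
rewrite rec_succ, beta2_sub; sub_simpl; reflexivity.
Qed.

Lemma mult_0 x : x ⊗ zero == zero.
Proof. unfold multC at 1; rewrite beta2; sub_simpl; apply rec_zero. Qed.

Lemma mult_S x y : x ⊗ S' y == x ⊗ y ⊕ x.
Proof.
assert (E : x ⊗ y == rec y zero
  (tm_sub (scons (S' y) (scons x ids)) (lam2 (plusC · v1 · v3))))
  by (unfold multC; rewrite beta2; sub_simpl; reflexivity).
rewrite E.
unfold multC; rewrite beta2; sub_simpl.
rewrite rec_succ, beta2_sub; sub_simpl; reflexivity.
Qed.

Lemma pred_0 : predC · zero == zero.
Proof. unfold predC at 1; rewrite beta1; sub_simpl; apply rec_zero. Qed.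

Lemma pred_S x : predC · S' x == x.
Proof. unfold predC at 1; rewrite beta1; sub_simpl; rewrite rec_succ; apply beta2_sub. Qed.

Lemma monus_0 x : x ∸ zero == x.
Proof. unfold monusC at 1; rewrite beta2; sub_simpl; apply rec_zero. Qed.

Lemma monus_S x y : x ∸ S' y == predC · (x ∸ y).
Proof.
assert (E : x ∸ y == rec y x
  (tm_sub (scons (S' y) (scons x ids)) (lam2 (predC · v1))))
  by (unfold monusC; rewrite beta2; sub_simpl; reflexivity).
rewrite E.
unfold monusC; rewrite beta2; sub_simpl.
rewrite rec_succ, beta2_sub; sub_simpl; reflexivity.
Qed.

Lemma min_eq x y : minC · x · y == x ∸ (x ∸ y).
Proof. unfold minC at 1; apply beta2. Qed.

Lemma sg_0 : sgC · zero == zero.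
Proof. unfold sgC at 1; rewrite beta1; sub_simpl; apply rec_zero. Qed.

Lemma sg_S x : sgC · S' x == numeral 1.
Proof. unfold sgC at 1; rewrite beta1; sub_simpl; rewrite rec_succ; apply beta2_sub. Qed.

Lemma quot_0 k : quotC · zero · k == zero.
Proof. unfold quotC at 1; rewrite beta2; sub_simpl; apply rec_zero. Qed.

Lemma quot_S n k :
  quotC · S' n · k ==
  quotC · n · k ⊕ sgC · (S' (S' n) ∸ (S' k ⊗ S' (quotC · n · k))).
Proof.
assert (E : quotC · n · k == rec n zero
  (tm_sub (scons k (scons (S' n) ids)) (lam2 (v1 ⊕ sgC · (S' (S' v0) ∸ (S' v2 ⊗ S' v1))))))
  by (unfold quotC at 1; rewrite beta2; reflexivity).
rewrite E.
unfold quotC at 1; rewrite beta2; sub_simpl.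
rewrite rec_succ, beta2_sub; sub_simpl; reflexivity.
Qed.

Lemma pow2_0 : pow2C · zero == numeral 1.
Proof. unfold pow2C at 1; rewrite beta1; sub_simpl; apply rec_zero. Qed.

Lemma pow2_S n : pow2C · S' n == pow2C · n ⊕ pow2C · n.
Proof.
assert (E : pow2C · n ==
  rec n (numeral 1) (tm_sub (scons (S' n) ids) (lam2 (v1 ⊕ v1))))
  by (unfold pow2C at 1; rewrite beta1; reflexivity).
rewrite E.
unfold pow2C at 1; rewrite beta1; sub_simpl.
rewrite rec_succ, beta2_sub; sub_simpl; reflexivity.
Qed.

Lemma norm_0 g : normC · g · zero == g · zero.
Proof. unfold normC at 1; rewrite beta2; sub_simpl; apply rec_zero. Qed.

Lemma norm_1 g : normC · g · numeral 1 == g · numeral 1.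
Proof.
unfold normC at 1; rewrite beta2; sub_simpl; change (numeral 1) with (@S' G zero) at 1.
rewrite rec_succ, beta2_sub; sub_simpl; apply rec_zero.
Qed.

Lemma norm_SS g n :
  normC · g · S' (S' n) == minC · (g · S' (S' n)) · numeral 2.
Proof.
unfold normC at 1; rewrite beta2; sub_simpl.
rewrite rec_succ, beta2_sub; sub_simpl.
rewrite rec_succ, beta2_sub; sub_simpl; reflexivity.
Qed.

Lemma pos_0 g : posC · g · zero == g · zero.
Proof. unfold posC at 1; rewrite beta2; sub_simpl; rewrite rec_zero; apply norm_0. Qed.

Lemma pos_S g n :
  posC · g · S' n == posC · g · n ⊕ posC · g · n ⊕ normC · g · S' (S' n).
Proof.
assert (E : posC · g · n == rec n (normC · g · zero)
  (tm_sub (scons (S' n) (scons g ids)) (lam2 (v1 ⊕ v1 ⊕ normC · v3 · S' (S' v0)))))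
  by (unfold posC at 1; rewrite beta2; reflexivity).
rewrite E.
unfold posC at 1; rewrite beta2; sub_simpl.
rewrite rec_succ, beta2_sub; sub_simpl; reflexivity.
Qed.

Lemma neg_0 g : negC · g · zero == g · numeral 1.
Proof. unfold negC at 1; rewrite beta2; sub_simpl; rewrite rec_zero; apply norm_1. Qed.

Lemma neg_S g n : negC · g · S' n == S' (negC · g · n ⊕ negC · g · n).
Proof.
assert (E : negC · g · n == rec n (normC · g · numeral 1)
  (tm_sub (scons (S' n) (scons g ids)) (lam2 (S' (v1 ⊕ v1)))))
  by (unfold negC at 1; rewrite beta2; reflexivity).
rewrite E.
unfold negC at 1; rewrite beta2; sub_simpl.
rewrite rec_succ, beta2_sub; sub_simpl; reflexivity.
Qed.

Lemma nat_0 m : natRC · m · zero == m.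
Proof. unfold natRC at 1; rewrite beta2; sub_simpl; apply rec_zero. Qed.

Lemma nat_S m n : natRC · m · S' n == sgC · n.
Proof. unfold natRC at 1; rewrite beta2; sub_simpl; rewrite rec_succ; apply beta2_sub. Qed.

Lemma inv_0 k : invRC · k · zero == quotC · numeral 1 · k.
Proof. unfold invRC at 1; rewrite beta2; sub_simpl; apply rec_zero. Qed.

Lemma inv_1 k : invRC · k · numeral 1 == zero.
Proof.
unfold invRC at 1; rewrite beta2; sub_simpl; change (numeral 1) with (@S' G zero) at 1.
rewrite rec_succ, beta2_sub; sub_simpl; apply rec_zero.
Qed.

Lemma inv_SS k n :
  invRC · k · S' (S' n) ==
  numeral 1 ⊕ quotC · (pow2C · S' n) · k ∸ numeral 2 ⊗ (quotC · (pow2C · n) · k).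
Proof.
unfold invRC at 1; rewrite beta2; sub_simpl.
rewrite rec_succ, beta2_sub; sub_simpl.
rewrite rec_succ, beta2_sub; sub_simpl; reflexivity.
Qed.

Lemma convdigit_eq a c p q n :
  let l := a · S' (S' (S' n)) ⊕ numeral 8 ⊗ q in
  let r := c · S' (S' (S' n)) ⊕ numeral 8 ⊗ p in
  convdigitC · a · c · p · q · n ==
  (numeral 1 ⊕ sgC · (l ∸ S' r)) ∸ sgC · (r ∸ S' l).
Proof. intros; unfold convdigitC at 1; rewrite beta2, beta3_sub; reflexivity. Qed.

Lemma convpos0_eq a c :
  convpos0C · a · c ==
  quotC · ((a · numeral 2 ∸ c · numeral 2) ⊕ numeral 2) · numeral 3.
Proof. unfold convpos0C at 1; apply beta2. Qed.

Lemma convneg0_eq a c :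
  convneg0C · a · c ==
  quotC · ((c · numeral 2 ∸ a · numeral 2) ⊕ numeral 2) · numeral 3.
Proof. unfold convneg0C at 1; apply beta2. Qed.

Lemma convneg_0 a c : convnegC · a · c · zero == convneg0C · a · c.
Proof. unfold convnegC at 1; rewrite beta3; sub_simpl; apply rec_zero. Qed.

Lemma convneg_S a c n :
  convnegC · a · c · S' n == S' (convnegC · a · c · n ⊕ convnegC · a · c · n).
Proof.
assert (E : convnegC · a · c · n == rec n (convneg0C · a · c)
  (tm_sub (scons (S' n) (scons c (scons a ids))) (lam2 (S' (v1 ⊕ v1)))))
  by (unfold convnegC at 1; rewrite beta3; reflexivity).
rewrite E.
unfold convnegC at 1; rewrite beta3; sub_simpl.
rewrite rec_succ, beta2_sub; sub_simpl; reflexivity.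
Qed.

Lemma convpos_0 a c : convposC · a · c · zero == convpos0C · a · c.
Proof. unfold convposC at 1; rewrite beta3; sub_simpl; apply rec_zero. Qed.

Lemma convpos_S a c n :
  convposC · a · c · S' n ==
  convposC · a · c · n ⊕ convposC · a · c · n
  ⊕ convdigitC · a · c · (convposC · a · c · n) · (convnegC · a · c · n) · n.
Proof.
assert (E : convposC · a · c · n == rec n (convpos0C · a · c)
  (tm_sub (scons (S' n) (scons c (scons a ids)))
    (lam2 (v1 ⊕ v1 ⊕ convdigitC · v4 · v3 · v1 · (convnegC · v4 · v3 · v0) · v0))))
  by (unfold convposC at 1; rewrite beta3; reflexivity).
rewrite E.
unfold convposC at 1; rewrite beta3; sub_simpl.
rewrite rec_succ, beta2_sub; sub_simpl; reflexivity.
Qed.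

Lemma conv_0 a c : convC · a · c · zero == convpos0C · a · c.
Proof. unfold convC at 1; rewrite beta3; sub_simpl; apply rec_zero. Qed.

Lemma conv_1 a c : convC · a · c · numeral 1 == convneg0C · a · c.
Proof.
unfold convC at 1; rewrite beta3; sub_simpl; change (numeral 1) with (@S' G zero) at 1.
rewrite rec_succ, beta2_sub; sub_simpl; apply rec_zero.
Qed.

Lemma conv_SS a c n :
  convC · a · c · S' (S' n) ==
  convdigitC · a · c · (convposC · a · c · n) · (convnegC · a · c · n) · n.
Proof.
unfold convC at 1; rewrite beta3; sub_simpl.
rewrite rec_succ, beta2_sub; sub_simpl.
rewrite rec_succ, beta2_sub; sub_simpl; reflexivity.
Qed.

End Recursion.

(** The approximating sequences are hidden, since only their values matter. They are chosen before
    [H], so that the same ones serve in every branch of a case distinction. *)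
Lemma add_eq G (x y : tm G T1) :
  exists a c, forall H, heq H (x +R y) (convC · a · c) /\
    (forall n, heq H (a · n) (posC · x · n ⊕ posC · y · n)) /\
    (forall n, heq H (c · n) (negC · x · n ⊕ negC · y · n)).
Proof.
set (s := scons y (scons x ids)).
exists (tm_sub s (lam (posC · v2 · v0 ⊕ posC · v1 · v0))),
  (tm_sub s (lam (negC · v2 · v0 ⊕ negC · v1 · v0))).
intros H; repeat apply conj; intros.
- unfold addRC; rewrite beta2; subst s; sub_simpl; reflexivity.
- rewrite beta_sub; subst s; sub_simpl; reflexivity.
- rewrite beta_sub; subst s; sub_simpl; reflexivity.
Qed.

Opaque plusC multC predC monusC minC sgC quotC pow2C normC posC negC convdigitC
  convpos0C convneg0C convnegC convposC convC addRC natRC invRC.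

(** * Elementary arithmetic *)

Lemma induct G (H : list (fm G)) (A : fm (T0 :: G)) t :
  H ⊩ fm_sub (scons zero ids) A ->
  (forall H', incl (map (fm_wk T0) H) H' -> H' ⊩ A ->
    H' ⊩ fm_sub (scons (S' v0) tail_sub) A) ->
  H ⊩ fm_sub (scons t ids) A.
Proof.
intros D0 DS.
refine (@pr_allE _ _ _ _ A t _).
refine (pr_impE (pr_impE (@pr_axiom _ _ H _ (ax_TM (ax_induction A))) D0) _).
apply pr_allI, pr_impI, DS; [now apply incl_tl|apply pr_head].
Qed.

Lemma heq_induct G (H : list (fm G)) (s t : tm (T0 :: G) T0) x :
  heq H (tm_sub (scons zero ids) s) (tm_sub (scons zero ids) t) ->
  (forall H', incl (map (fm_wk T0) H) H' -> heq H' s t ->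
   heq H' (tm_sub (scons (S' v0) tail_sub) s) (tm_sub (scons (S' v0) tail_sub) t)) ->
  heq H (tm_sub (scons x ids) s) (tm_sub (scons x ids) t).
Proof.
intros D0 DS; apply heq_of_eq.
apply (@induct _ _ (s =0 t)); [exact (eq_of_heq D0)|].
intros H' I IH; apply eq_of_heq, (DS H' I), heq_of_eq, IH.
Qed.

Ltac fm_induction A x :=
  match goal with |- ?H ⊩ _ =>
    let E := fresh in
    assert (E : H ⊩ fm_sub (scons x ids) A);
    [apply induct; [|intros H' _ IH]; cbn [fm_sub]; sub_simpl
    |revert E; cbn [fm_sub]; sub_simpl; exact (fun E => E)]
  end.

Ltac heq_induction s t x :=
  match goal with |- heq ?H _ _ =>
    let E := fresh in
    assert (E : heq H (tm_sub (scons x ids) s) (tm_sub (scons x ids) t));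
    [apply heq_induct; [|intros H' _ IH]; sub_simpl
    |revert E; sub_simpl; exact (fun E => E)]
  end.

Lemma plus_0l G (H : list (fm G)) x : heq H (zero ⊕ x) x.
Proof.
heq_induction (zero ⊕ v0 : tm (T0 :: G) T0) (v0 : tm (T0 :: G) T0) x.
- apply plus_0.
- now rewrite plus_S, IH.
Qed.

Lemma plus_Sl G (H : list (fm G)) x y : heq H (S' x ⊕ y) (S' (x ⊕ y)).
Proof.
heq_induction (S' (tm_wk T0 x) ⊕ v0) (S' (tm_wk T0 x ⊕ v0)) y.
- now rewrite !plus_0.
- now rewrite !plus_S, IH.
Qed.

Lemma plus_comm G (H : list (fm G)) x y : heq H (x ⊕ y) (y ⊕ x).
Proof.
heq_induction (tm_wk T0 x ⊕ v0) (v0 ⊕ tm_wk T0 x) y.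
- now rewrite plus_0, plus_0l.
- now rewrite plus_S, plus_Sl, IH.
Qed.

Lemma plus_assoc G (H : list (fm G)) x y z : heq H (x ⊕ y ⊕ z) (x ⊕ (y ⊕ z)).
Proof.
heq_induction (tm_wk T0 x ⊕ tm_wk T0 y ⊕ v0) (tm_wk T0 x ⊕ (tm_wk T0 y ⊕ v0)) z.
- now rewrite !plus_0.
- now rewrite !plus_S, IH.
Qed.

Lemma monus_SS G (H : list (fm G)) x y : heq H (S' x ∸ S' y) (x ∸ y).
Proof.
heq_induction (S' (tm_wk T0 x) ∸ S' v0) (tm_wk T0 x ∸ v0) y.
- now rewrite monus_S, !monus_0, pred_S.
- now rewrite (monus_S _ _ (S' v0)), IH, monus_S.
Qed.

Lemma zero_monus G (H : list (fm G)) x : heq H (zero ∸ x) zero.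
Proof.
heq_induction (zero ∸ v0 : tm (T0 :: G) T0) (zero : tm (T0 :: G) T0) x.
- apply monus_0.
- now rewrite monus_S, IH, pred_0.
Qed.

Lemma monus_plus2r G (H : list (fm G)) x y z : heq H (x ⊕ z ∸ (y ⊕ z)) (x ∸ y).
Proof.
heq_induction (tm_wk T0 x ⊕ v0 ∸ (tm_wk T0 y ⊕ v0)) (tm_wk T0 x ∸ tm_wk T0 y) z.
- now rewrite !plus_0.
- now rewrite !plus_S, monus_SS.
Qed.

Lemma monus_plus G (H : list (fm G)) x y : heq H (x ∸ (x ⊕ y)) zero.
Proof.
rewrite (plus_comm H x y).
rewrite <- (zero_monus H y), <- (monus_plus2r H zero y x), plus_0l; reflexivity.
Qed.

Lemma plus_monus G (H : list (fm G)) x y : heq H (x ⊕ y ∸ x) y.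
Proof.
rewrite (plus_comm H x y).
rewrite <- (plus_0l H x) at 2.
now rewrite monus_plus2r, monus_0.
Qed.

Lemma monus_diag G (H : list (fm G)) x : heq H (x ∸ x) zero.
Proof. now rewrite <- (plus_0 H x) at 1; rewrite plus_monus. Qed.

(** Case distinctions are put in continuation form: each branch works under an arbitrary larger list
    of assumptions, with its case hypothesis already usable for rewriting. *)
Lemma pr_or_heq G (H : list (fm G)) x y z w C :
  H ⊩ (x =0 y) ∨ (z =0 w) ->
  (forall H', incl H H' -> heq H' x y -> H' ⊩ C) ->
  (forall H', incl H H' -> heq H' z w -> H' ⊩ C) -> H ⊩ C.
Proof.
intros D DL DR; apply (pr_orE D).
- apply DL; [now apply incl_tl|apply heq_of_eq, pr_head].
- apply DR; [now apply incl_tl|apply heq_of_eq, pr_head].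
Qed.

Lemma zero_or_succ G (H : list (fm G)) x C :
  (forall H', incl H H' -> heq H' x zero -> H' ⊩ C) ->
  (forall H', incl H H' -> heq H' x (S' (predC · x)) -> H' ⊩ C) -> H ⊩ C.
Proof.
apply (@pr_or_heq _ H).
fm_induction (v0 =0 zero ∨ v0 =0 S' (predC · v0) : fm (T0 :: G)) x.
- apply pr_orI1, pr_refl.
- apply pr_orI2, eq_of_heq; now rewrite pred_S.
Qed.

(** The differences serve as explicit witnesses, so that a single induction on
    [y] suffices. *)
Lemma le_or_gt_witness G (H : list (fm G)) x y :
  H ⊩ (y =0 x ⊕ (y ∸ x)) ∨ (x =0 S' y ⊕ (x ∸ S' y)).
Proof.
fm_induction (v0 =0 tm_wk T0 x ⊕ (v0 ∸ tm_wk T0 x)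
  ∨ tm_wk T0 x =0 S' v0 ⊕ (tm_wk T0 x ∸ S' v0)) y.
- apply (@zero_or_succ _ _ x); intros H' _ E.
  + apply pr_orI1, eq_of_heq; now rewrite E, plus_0l, monus_0.
  + apply pr_orI2, eq_of_heq.
    now rewrite plus_Sl, plus_0l, monus_S, monus_0, <- E.
- refine (pr_or_heq IH _ _); intros K _ E.
  + apply pr_orI1, eq_of_heq.
    assert (E' : heq K (S' v0) (tm_wk T0 x ⊕ S' (v0 ∸ tm_wk T0 x)))
      by (rewrite plus_S, <- E; reflexivity).
    rewrite E'; now rewrite plus_monus.
  + apply (@zero_or_succ _ _ (tm_wk T0 x ∸ S' v0)); intros H'' I F;
    apply (fun E => heq_weaken E I) in E; rewrite F in E.
    * apply pr_orI1, eq_of_heq.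
      rewrite plus_0 in E; now rewrite E, monus_diag, plus_0.
    * apply pr_orI2, eq_of_heq.
      rewrite monus_S, F, pred_S, plus_Sl, <- plus_S; exact E.
Qed.

Lemma le_intro G (H : list (fm G)) x y z : heq H y (x ⊕ z) -> H ⊩ x ≤0 y.
Proof. intros E; apply eq_of_heq; now rewrite E, monus_plus. Qed.

Lemma succ_not_zero G (H : list (fm G)) x C : heq H (S' x) zero -> H ⊩ C.
Proof.
intros E; apply pr_exfalso, (pr_impE (A := S' x =0 zero)).
- apply pr_axiom, ax_TM, ax_succ_zero.
- now apply eq_of_heq.
Qed.

Lemma le_elim G (H : list (fm G)) x y : H ⊩ x ≤0 y -> heq H y (x ⊕ (y ∸ x)).
Proof.
intros D%heq_of_eq; apply heq_of_eq.
apply (pr_or_heq (le_or_gt_witness H x y)); intros H' I E.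
- now apply eq_of_heq.
- apply (fun E => heq_weaken E I) in D.
  (* In this case [x ∸ y] becomes a successor, while [D] says that it is zero. *)
  rewrite E, plus_Sl, <- plus_S, plus_monus in D.
  exact (succ_not_zero _ D).
Qed.

Lemma le_cases G (H : list (fm G)) x y C :
  (forall H', incl H H' -> H' ⊩ x ≤0 y -> H' ⊩ C) ->
  (forall H', incl H H' -> H' ⊩ y <0 x -> H' ⊩ C) -> H ⊩ C.
Proof.
intros L R; apply (pr_or_heq (le_or_gt_witness H x y)); intros H' I E%le_intro.
- exact (L H' I E).
- exact (R H' I E).
Qed.

Lemma plus_swap G (H : list (fm G)) x y z w :
  heq H (x ⊕ y ⊕ (z ⊕ w)) (x ⊕ z ⊕ (y ⊕ w)).
Proof.
rewrite !plus_assoc, <- (plus_assoc H y z), (plus_comm H y z), !plus_assoc.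
reflexivity.
Qed.

Lemma le_plus G (H : list (fm G)) x y z w :
  H ⊩ x ≤0 y -> H ⊩ z ≤0 w -> H ⊩ x ⊕ z ≤0 y ⊕ w.
Proof.
intros D%le_elim E%le_elim; apply (le_intro (z := (y ∸ x) ⊕ (w ∸ z))).
now rewrite D, E, <- plus_swap at 1.
Qed.

Lemma le_heq G (H : list (fm G)) x y : heq H x y -> H ⊩ x ≤0 y.
Proof. intros E; apply eq_of_heq; now rewrite E, monus_diag. Qed.

Lemma le_congr G (H : list (fm G)) x x' y y' :
  heq H x x' -> heq H y y' -> H ⊩ x ≤0 y -> H ⊩ x' ≤0 y'.
Proof. intros E F D%heq_of_eq; apply eq_of_heq; now rewrite <- E, <- F. Qed.

(** * Linear arithmetic *)

Inductive lexp := LAt (i : nat) | LZ | LN (k : nat) | LS (e : lexp) | LP (e f : lexp)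
  | LM (k : nat) (e : lexp).

Section Linear.
Context {G : ctx} (H : list (fm G)).

Fixpoint lden (xs : list (tm G T0)) (e : lexp) : tm G T0 :=
  match e with
  | LAt i => nth i xs zero
  | LZ => zero
  | LN k => numeral k
  | LS e => S' (lden xs e)
  | LP e f => lden xs e ⊕ lden xs f
  | LM k e => numeral k ⊗ lden xs e
  end.

Fixpoint nmul (k : nat) (x : tm G T0) : tm G T0 :=
  match k with O => zero | S k => nmul k x ⊕ x end.

Fixpoint lin (xs : list (tm G T0)) (v : list nat) {struct v} : tm G T0 :=
  match v, xs with
  | c :: v, x :: xs => nmul c x ⊕ lin xs v
  | _, _ => zero
  end.

Fixpoint vadd (v w : list nat) : list nat :=
  match v, w with
  | a :: v, b :: w => (a + b)%nat :: vadd v w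
  | [], _ => w
  | _, [] => v
  end.

Fixpoint vmul (k : nat) (v : list nat) : list nat :=
  match k with O => [] | S k => vadd (vmul k v) v end.

(** The constant term comes first, so atom i has position i + 1 and the vector is evaluated at
    [numeral 1 :: xs]. *)
Fixpoint lnorm (e : lexp) : list nat :=
  match e with
  | LAt i => O :: repeat O i ++ [1%nat]
  | LZ => []
  | LN k => [k]
  | LS e => vadd (lnorm e) [1%nat]
  | LP e f => vadd (lnorm e) (lnorm f)
  | LM k e => vmul k (lnorm e)
  end.

#[export] Instance nmul_heq k : Proper (heq H ==> heq H) (nmul k).
Proof. intros x y E; induction k; cbn; [reflexivity|now rewrite IHk, E]. Qed.

Lemma nmul_add a b x : heq H (nmul (a + b) x) (nmul a x ⊕ nmul b x).
Proof.
rewrite Nat.add_comm; induction b; cbn.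
- now rewrite plus_0.
- now rewrite IHb, plus_assoc.
Qed.

Lemma lin_vadd v w xs : heq H (lin xs (vadd v w)) (lin xs v ⊕ lin xs w).
Proof.
revert w xs; induction v as [|a v IH]; intros w xs.
- cbn; now rewrite plus_0l.
- destruct w as [|b w], xs as [|x xs]; cbn; rewrite ?plus_0; try reflexivity.
  now rewrite IH, nmul_add, plus_swap.
Qed.

Lemma lin_vmul k v xs : heq H (lin xs (vmul k v)) (nmul k (lin xs v)).
Proof.
induction k; cbn.
- destruct xs; reflexivity.
- now rewrite lin_vadd, IHk.
Qed.

Lemma lin_unit i xs : heq H (lin xs (repeat O i ++ [1%nat])) (nth i xs zero).
Proof.
revert xs; induction i; intros [|x xs]; cbn; try reflexivity.
- rewrite plus_0l; destruct xs; apply plus_0.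
- now rewrite plus_0l.
Qed.

End Linear.

(** [multC] recurses on its right argument, whereas [nmul] recurses on the meta-level number on the
    left. Hence an object-level induction on [x], with a meta-level induction on [k] in each
    case. *)
Lemma mult_numeral G (H : list (fm G)) k x : heq H (numeral k ⊗ x) (nmul k x).
Proof.
assert (E : forall D (s : sub (T0 :: G) D), tm_sub s (nmul k v0) = nmul k (tm_sub s v0)).
{ intros; induction k; cbn [nmul]; sub_simpl; now rewrite ?IHk. }
assert (F : heq H (tm_sub (scons x ids) (numeral k ⊗ v0)) (tm_sub (scons x ids) (nmul k v0))).
{ apply heq_induct; [|intros H' _ IH]; rewrite ?E; sub_simpl.
  - rewrite mult_0; clear; induction k; cbn; [reflexivity|now rewrite plus_0].
  - rewrite mult_S, IH; clear; induction k; cbn [nmul].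
    + change (@numeral (T0 :: G) 0) with (@zero (T0 :: G)); now rewrite plus_0.
    + change (@numeral (T0 :: G) (S k)) with (S' (@numeral (T0 :: G) k)).
      now rewrite <- IHk, !plus_S, !plus_assoc, (plus_comm _ v0). }
revert F; rewrite E; sub_simpl; exact (fun F => F).
Qed.

Lemma lnorm_sound G (H : list (fm G)) xs e :
  heq H (lin (numeral 1 :: xs) (lnorm e)) (lden xs e).
Proof.
induction e; cbn [lnorm lden].
- cbn; now rewrite plus_0l, lin_unit.
- reflexivity.
- cbn; rewrite plus_0; induction k; [reflexivity|cbn].
  change (@numeral G 1) with (@S' G zero) at 2.
  change (@numeral G (S k)) with (S' (@numeral G k)).
  now rewrite IHk, plus_S, plus_0.
- rewrite lin_vadd, IHe; cbn.
  change (numeral 1) with (@S' G zero).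
  now rewrite !plus_0, !plus_S, !plus_0.
- now rewrite lin_vadd, IHe1, IHe2.
- now rewrite lin_vmul, IHe, mult_numeral.
Qed.

(** * Certificates for linear inequalities *)

Fixpoint vle (v w : list nat) : bool :=
  match v, w with
  | [], _ => true
  | a :: v, [] => Nat.eqb a 0 && vle v []
  | a :: v, b :: w => Nat.leb a b && vle v w
  end.

(** The witness is the coefficientwise difference of [w] and [v]; it does not depend on the
    atoms. *)
Lemma vle_sound v w : vle v w = true ->
  exists u, forall G (H : list (fm G)) xs,
    heq H (lin xs w) (lin xs v ⊕ lin xs u).
Proof.
revert w; induction v as [|a v IH]; intros w L.
- exists w; intros; cbn; now rewrite plus_0l.
- destruct w as [|b w]; apply andb_prop in L as [L1 L2];
  destruct (IH _ L2) as [u Hu].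
  + apply Nat.eqb_eq in L1 as ->.
    exists (0%nat :: u); intros G H [|x xs]; cbn; rewrite ?plus_0l; [reflexivity|].
    rewrite <- Hu; destruct xs; reflexivity.
  + apply Nat.leb_le in L1.
    exists ((b - a)%nat :: u); intros G H [|x xs]; cbn; [now rewrite plus_0|].
    rewrite Hu, <- plus_swap, <- nmul_add.
    now replace (a + (b - a))%nat with b by now rewrite Nat.add_comm, Nat.sub_add.
Qed.

(** The facts [l ≤0 r], multiplied by the numbers in [ks], add up to
    [L ≤0 R] where the linear form [L] exceeds [R]. *)
Fixpoint lsum (fs : list (lexp * lexp)) (ks : list nat) : list nat * list nat :=
  match fs, ks with
  | (l, r) :: fs, k :: ks =>
      let (L, R) := lsum fs ks in
      (vadd (vmul k (lnorm l)) L, vadd (vmul k (lnorm r)) R)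
  | _, _ => ([], [])
  end.

Definition lcheck fs ks : bool :=
  let (L, R) := lsum fs ks in vle (vadd [1%nat] R) L.

Definition facts {G} (H : list (fm G)) : list (tm G T0 * tm G T0) -> Prop :=
  Forall (fun f => H ⊩ fst f ≤0 snd f).

Lemma facts_le G (H : list (fm G)) s t fs :
  H ⊩ s ≤0 t -> facts H fs -> facts H ((s, t) :: fs).
Proof. now constructor. Qed.

Lemma facts_heq G (H : list (fm G)) s t fs :
  heq H s t -> facts H fs -> facts H ((s, t) :: (t, s) :: fs).
Proof.
intros E F; constructor; [exact (le_heq E)|].
constructor; [exact (le_heq (symmetry E))|exact F].
Qed.

Lemma facts_eq G (H : list (fm G)) s t fs :
  H ⊩ s =0 t -> facts H fs -> facts H ((s, t) :: (t, s) :: fs).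
Proof. intros D; exact (facts_heq (heq_of_eq D)). Qed.

Lemma facts_weaken G (H H' : list (fm G)) fs :
  facts H fs -> incl H H' -> facts H' fs.
Proof.
intros F I; refine (Forall_impl _ _ F); intros f D; exact (weaken D I).
Qed.

Lemma nmul_le G (H : list (fm G)) k x y : H ⊩ x ≤0 y -> H ⊩ nmul k x ≤0 nmul k y.
Proof.
intros D; induction k; cbn; [now apply le_heq|now apply le_plus].
Qed.

Definition dens {G} (xs : list (tm G T0)) :=
  map (fun f : lexp * lexp => (lden xs (fst f), lden xs (snd f))).

Lemma lsum_sound G (H : list (fm G)) xs fs ks :
  facts H (dens xs fs) ->
  H ⊩ lin (numeral 1 :: xs) (fst (lsum fs ks))
      ≤0 lin (numeral 1 :: xs) (snd (lsum fs ks)).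
Proof.
revert ks; induction fs as [|[l r] fs IH]; intros ks F; [now apply le_heq|].
destruct ks as [|k ks]; [now apply le_heq|].
inversion_clear F as [|? ? D F'].
cbn [lsum]; specialize (IH ks F'); destruct (lsum fs ks) as [L R]; cbn in IH, D |- *.
refine (le_congr _ _ (le_plus (nmul_le k D) IH));
  now rewrite lin_vadd, lin_vmul, lnorm_sound.
Qed.

(** Atoms denote natural numbers, so coefficientwise domination of 1 + R by L makes [L ∸ R] a
    successor, whereas the weighted sum of the facts makes it zero. *)
Lemma lcheck_sound G (H : list (fm G)) xs fs ks C :
  facts H (dens xs fs) -> lcheck fs ks = true -> H ⊩ C.
Proof.
intros F K; unfold lcheck in K.
pose proof (lsum_sound xs fs ks F) as D; destruct (lsum fs ks) as [L R]; cbn in D.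
destruct (vle_sound _ _ K) as [u E].
apply heq_of_eq in D; rewrite (E G H), lin_vadd in D.
set (r := lin _ R) in D; set (w := lin _ u) in D.
apply (succ_not_zero (x := w)); rewrite <- D.
cbn; change (numeral 1) with (@S' G zero).
now rewrite plus_0, plus_0l, !plus_Sl, plus_0l, <- plus_S, plus_monus.
Qed.

(** An argument by contradiction: the negated goal is prepended to the facts. *)
Lemma lcheck_le G (H : list (fm G)) xs l r fs ks :
  facts H (dens xs fs) -> lcheck ((LS r, l) :: fs) ks = true ->
  H ⊩ lden xs l ≤0 lden xs r.
Proof.
intros F K; apply (@le_cases _ _ (lden xs l) (lden xs r)); intros H' I D;
  [exact D|].
refine (lcheck_sound xs ((LS r, l) :: fs) ks _ _ K).
constructor; [exact D|exact (facts_weaken F I)].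
Qed.

(** Fourier-Motzkin elimination, as an untrusted search for the multipliers.
    A row [(v, c)] is the linear form [v], with constant term first, that is
    ≤ 0 as the sum of the facts multiplied by [c]. *)
Definition row : Type := list Z * list nat.

Fixpoint zcomb (a b : Z) (v w : list Z) : list Z :=
  match v, w with
  | x :: v, y :: w => (a * x + b * y)%Z :: zcomb a b v w
  | _, [] => map (Z.mul a) v
  | [], _ => map (Z.mul b) w
  end.

Fixpoint ncomb (a b : nat) (v w : list nat) : list nat :=
  match v, w with
  | x :: v, y :: w => (a * x + b * y)%nat :: ncomb a b v w
  | _, [] => map (Nat.mul a) v
  | [], _ => map (Nat.mul b) w
  end.

Definition rcomb (a b : Z) (r s : row) : row :=
  let g := Z.gcd a b in
  let a := Z.div a g in let b := Z.div b g in
  (zcomb a b (fst r) (fst s), ncomb (Z.to_nat a) (Z.to_nat b) (snd r) (snd s)).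

Fixpoint zset0 (j : nat) (v : list Z) : list Z :=
  match j, v with
  | _, [] => []
  | O, _ :: v => 0%Z :: v
  | S j, x :: v => x :: zset0 j v
  end.

Definition coef (j : nat) (r : row) : Z := nth j (fst r) 0%Z.
Definition useful (r : row) : bool := existsb (Z.ltb 0) (fst r).
Definition contradictory (r : row) : bool :=
  (Z.ltb 0 (nth 0 (fst r) 0%Z) && forallb (Z.leb 0) (fst r))%bool.

(** Atoms being nonnegative, a row follows from any row that is coefficientwise at least as large;
    only maximal rows are kept. *)
Definition dedupe (rs : list row) : list row :=
  fold_right (fun r acc =>
    if existsb (fun s => forallb (fun d => Z.leb d 0) (zcomb 1 (-1) (fst r) (fst s))) acc
    then acc
    else r :: filter (fun s => negb
      (forallb (fun d => Z.leb d 0) (zcomb 1 (-1) (fst s) (fst r)))) acc) [] rs.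

(** Since atoms are nonnegative, a positive coefficient may be dropped and a
    row with a negative coefficient need not be kept. *)
Definition eliminate (j : nat) (rs : list row) : list row :=
  let pos := filter (fun r => Z.ltb 0 (coef j r)) rs in
  let neg := filter (fun r => Z.ltb (coef j r) 0) rs in
  let nil := filter (fun r => Z.eqb (coef j r) 0) rs in
  dedupe (filter useful
    (nil ++ map (fun r => (zset0 j (fst r), snd r)) pos ++
     flat_map (fun p => map (fun n =>
       rcomb (- coef j n) (coef j p) p n) neg) pos)).

Definition cost (rs : list row) (j : nat) : nat :=
  (length (filter (fun r => Z.ltb 0 (coef j r)) rs)
   * length (filter (fun r => Z.ltb (coef j r) 0) rs))%nat.

Fixpoint solve (fuel : nat) (js : list nat) (rs : list row) : list nat :=
  match find contradictory rs with
  | Some r => snd r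
  | None =>
      match fuel, js with
      | S fuel, j :: js' =>
          let best := fold_left (fun b i =>
            if Nat.ltb (cost rs i) (cost rs b) then i else b) js' j in
          solve fuel (filter (fun i => negb (Nat.eqb i best)) js)
            (eliminate best rs)
      | _, _ => []
      end
  end.

Definition multipliers (n : nat) (fs : list (lexp * lexp)) : list nat :=
  let m := length fs in
  let rows := map (fun p : nat * (lexp * lexp) =>
    let (i, f) := p in
    (zcomb 1 (-1) (map Z.of_nat (lnorm (fst f))) (map Z.of_nat (lnorm (snd f))),
     map (fun k => if Nat.eqb i k then 1%nat else 0%nat) (seq 0 m)))
    (combine (seq 0 m) fs) in
  solve n (seq 1 n) rows.

(** * Reification of linear goals *)

Ltac position x xs :=
  lazymatch xs with
  | [] => constr:(O)
  | x :: _ => constr:(O)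
  | _ :: ?xs => let i := position x xs in constr:(S i)
  end.

Ltac add_atoms t xs :=
  lazymatch t with
  | @zero _ => xs
  | numeral ?k => xs
  | S' ?s => add_atoms s xs
  | plusC · ?s · ?u => let xs := add_atoms s xs in add_atoms u xs
  | multC · numeral ?k · ?s => add_atoms s xs
  | _ => lazymatch xs with
    | context [t :: _] => xs
    | _ => constr:(t :: xs)
    end
  end.

Ltac reify xs t :=
  lazymatch t with
  | @zero _ => constr:(LZ)
  | numeral ?k => constr:(LN k)
  | S' ?s => let e := reify xs s in constr:(LS e)
  | plusC · ?s · ?u =>
      let e := reify xs s in let f := reify xs u in constr:(LP e f)
  | multC · numeral ?k · ?s => let e := reify xs s in constr:(LM k e)
  | _ => let i := position t xs in constr:(LAt i)
  end.

Ltac pairs_atoms fs xs :=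
  lazymatch fs with
  | [] => xs
  | (?l, ?r) :: ?fs =>
      let xs := add_atoms l xs in
      let xs := add_atoms r xs in
      pairs_atoms fs xs
  end.

Ltac reify_pairs xs fs :=
  lazymatch fs with
  | [] => constr:(@nil (lexp * lexp))
  | (?l, ?r) :: ?fs =>
      let l := reify xs l in
      let r := reify xs r in
      let fs := reify_pairs xs fs in
      constr:((l, r) :: fs)
  end.

Ltac collect p acc :=
  lazymatch p with
  | (?p, ?q) => let acc := collect q acc in collect p acc
  | _ =>
      lazymatch type of p with
      | heq _ _ _ => constr:(facts_heq p acc)
      | proves _ _ (?s ≤0 ?t) => constr:(facts_le p acc)
      | proves _ _ (?s =0 ?t) => constr:(facts_eq p acc)
      end
  end.

Ltac lin_le G H s t p :=
  let p := collect p (Forall_nil (fun f : tm G T0 * tm G T0 => H ⊩ fst f ≤0 snd f)) in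
  lazymatch type of p with
  | facts _ ?fs =>
    let xs := pairs_atoms ((S' t, s) :: fs) (@nil (tm G T0)) in
    let l := reify xs s in
    let r := reify xs t in
    let es := reify_pairs xs fs in
    let n := eval cbv in (length xs) in
    let ks := eval vm_compute in (multipliers n ((LS r, l) :: es)) in
    exact (@lcheck_le G H xs l r es ks p (eq_refl true))
  end.

Ltac lin_false G H C p :=
  let p := collect p (Forall_nil (fun f : tm G T0 * tm G T0 => H ⊩ fst f ≤0 snd f)) in
  lazymatch type of p with
  | facts _ ?fs =>
    let xs := pairs_atoms fs (@nil (tm G T0)) in
    let es := reify_pairs xs fs in
    let n := eval cbv in (length xs) in
    let ks := eval vm_compute in (multipliers n es) in
    exact (@lcheck_sound G H xs es ks C p (eq_refl true))
  end.

Lemma le_antisym G (H : list (fm G)) x y :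
  H ⊩ x ≤0 y -> H ⊩ y ≤0 x -> heq H x y.
Proof.
intros D E%heq_of_eq; apply le_elim in D; rewrite E, plus_0 in D.
now symmetry.
Qed.

(** [p] is a tuple of derivations of linear facts; contradictory facts prove any
    goal. *)
Ltac linear p :=
  lazymatch goal with
  | |- @proves _ ?G ?H (?s ≤0 ?t) => lin_le G H s t p
  | |- @proves _ ?G ?H (?s =0 ?t) => apply eq_of_heq; linear p
  | |- @heq ?G ?H _ ?s ?t =>
      apply le_antisym; [lin_le G H s t p|lin_le G H t s p]
  | |- @proves _ ?G ?H ?C => lin_false G H C p
  end.

(** * Signed digit reals *)

Ltac lift I :=
  lazymatch type of I with
  | incl ?H ?H' =>
    repeat match goal with
    | D : proves _ H _ |- _ => apply (fun D => weaken D I) in D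
    | E : heq H _ _ |- _ => apply (fun E => heq_weaken E I) in E
    end
  end.

Lemma sg_monus_le G (H : list (fm G)) x y :
  H ⊩ x ≤0 y -> heq H (sgC · (x ∸ y)) zero.
Proof. intros D%heq_of_eq; now rewrite D, sg_0. Qed.

Lemma sg_monus_lt G (H : list (fm G)) x y :
  H ⊩ y <0 x -> heq H (sgC · (x ∸ y)) (numeral 1).
Proof.
intros D%le_elim; now rewrite D, plus_Sl, <- plus_S, plus_monus, sg_S.
Qed.

Lemma min_le G (H : list (fm G)) x y : H ⊩ x ≤0 y -> heq H (minC · x · y) x.
Proof. intros D%heq_of_eq; now rewrite min_eq, D, monus_0. Qed.

Lemma min_le_r G (H : list (fm G)) x y : H ⊩ minC · x · y ≤0 y.
Proof.
apply (@le_cases _ _ x y); intros H' I D.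
- pose proof (min_le D) as E; linear (D, E).
- assert (D' : H' ⊩ y ≤0 x) by linear D.
  apply le_elim in D'.
  assert (E : heq H' x (x ∸ y ⊕ y)) by linear D'.
  apply le_heq; rewrite min_eq; rewrite E at 1; apply plus_monus.
Qed.

Lemma norm_digit G (H : list (fm G)) g n : H ⊩ normC · g · S' (S' n) ≤0 numeral 2.
Proof.
pose proof (norm_SS H g n) as E.
pose proof (min_le_r H (g · S' (S' n)) (numeral 2)) as D.
linear (E, D).
Qed.

Lemma quot_small G (H : list (fm G)) m k : H ⊩ m ≤0 k -> heq H (quotC · m · k) zero.
Proof.
intros D; apply heq_of_eq, (pr_impE (A := m ≤0 k)); [|exact D].
fm_induction (v0 ≤0 tm_wk T0 k ⟶ quotC · v0 · tm_wk T0 k =0 zero) m.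
- apply pr_impI, eq_of_heq, quot_0.
- apply pr_impI.
  set (K := tm_wk T0 k) in *.
  assert (F : (S' v0 ≤0 K) :: H' ⊩ S' v0 ≤0 K) by apply pr_head.
  assert (Q : heq ((S' v0 ≤0 K) :: H') (quotC · v0 · K) zero).
  { apply heq_of_eq; refine (pr_impE (weaken1 _ IH) _); linear F. }
  apply eq_of_heq; rewrite quot_S, Q.
  (* While the quotient is 0, it is incremented only when the new numerator reaches k + 1, which [F]
     excludes. *)
  rewrite plus_0l; apply sg_monus_le.
  pose proof (mult_S ((S' v0 ≤0 K) :: H') (S' K) zero) as E1.
  pose proof (mult_0 ((S' v0 ≤0 K) :: H') (S' K)) as E2.
  linear (F, E1, E2).
Qed.

(** Division by 4 with remainder, since [quotC] takes the divisor minus one. This is the division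
    that rounds A_2/4 at the start of the conversion. *)
Lemma quot3 G (H : list (fm G)) m :
  H ⊩ numeral 4 ⊗ (quotC · m · numeral 3) ≤0 m ∧
  m ≤0 numeral 4 ⊗ (quotC · m · numeral 3) ⊕ numeral 3.
Proof.
fm_induction (numeral 4 ⊗ (quotC · v0 · numeral 3) ≤0 v0 ∧
  v0 ≤0 numeral 4 ⊗ (quotC · v0 · numeral 3) ⊕ numeral 3 : fm (T0 :: G)) m.
- pose proof (quot_0 H (numeral 3)) as E; apply pr_andI; linear E.
- pose proof (quot_S H' v0 (numeral 3)) as E.
  pose proof (pr_andE1 IH) as I1; pose proof (pr_andE2 IH) as I2.
  apply (@le_cases _ _ (S' (S' v0)) (numeral 4 ⊗ S' (quotC · v0 · numeral 3)));
    intros H'' I D; lift I.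
  + pose proof (sg_monus_le D) as F.
    change (S' (numeral 3)) with (@numeral (T0 :: G) 4) in E.
    apply pr_andI; linear (E, I1, I2, D, F).
  + pose proof (sg_monus_lt D) as F.
    change (S' (numeral 3)) with (@numeral (T0 :: G) 4) in E.
    apply pr_andI; linear (E, I1, I2, D, F).
Qed.

(** * The conversion algorithm and addition of reals *)

Lemma convdigit_cases G (H : list (fm G)) a c p q n C :
  let l := a · S' (S' (S' n)) ⊕ numeral 8 ⊗ q in
  let r := c · S' (S' (S' n)) ⊕ numeral 8 ⊗ p in
  let e := convdigitC · a · c · p · q · n in
  (forall H', incl H H' -> H' ⊩ S' (S' r) ≤0 l -> heq H' e (numeral 2) -> H' ⊩ C) ->
  (forall H', incl H H' -> H' ⊩ S' (S' l) ≤0 r -> heq H' e zero -> H' ⊩ C) ->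
  (forall H', incl H H' -> H' ⊩ l ≤0 S' r -> H' ⊩ r ≤0 S' l ->
    heq H' e (numeral 1) -> H' ⊩ C) ->
  H ⊩ C.
Proof.
intros l r e D2 D0 D1.
pose proof (convdigit_eq H a c p q n) as E; cbv zeta in E.
fold l r e in E; clearbody l r e.
apply (@le_cases _ _ l (S' r)); intros H' I L.
- pose proof (sg_monus_le L) as SL.
  apply (@le_cases _ _ r (S' l)); intros H'' I' R.
  + assert (IT := incl_tran I I'); pose proof (sg_monus_le R) as SR; lift IT; lift I'.
    apply (D1 _ IT L R).
    rewrite E, SL, SR; now rewrite plus_0, monus_0.
  + assert (IT := incl_tran I I'); pose proof (sg_monus_lt R) as SR; lift IT; lift I'.
    apply (D0 _ IT R).
    rewrite E, SL, SR; now rewrite plus_0, monus_diag.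
- pose proof (sg_monus_lt L) as SL; lift I.
  apply (D2 _ I L).
  (* The tests for the digits 1 and -1 exclude each other. *)
  assert (R : H' ⊩ r ≤0 S' l) by linear L.
  pose proof (sg_monus_le R) as SR.
  rewrite E, SL, SR, monus_0; linear SR.
Qed.

Lemma convdigit_le G (H : list (fm G)) a c p q n :
  H ⊩ convdigitC · a · c · p · q · n ≤0 numeral 2.
Proof.
apply (@convdigit_cases _ _ a c p q n); cbv zeta; intros H' I *;
  [intros _ E|intros _ E|intros _ _ E]; linear E.
Qed.

Lemma neg_conv G (H : list (fm G)) a c n :
  heq H (negC · (convC · a · c) · n) (convnegC · a · c · n).
Proof.
heq_induction (negC · (convC · tm_wk T0 a · tm_wk T0 c) · v0)
  (convnegC · tm_wk T0 a · tm_wk T0 c · v0) n.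
- now rewrite neg_0, conv_1, convneg_0.
- now rewrite neg_S, convneg_S, IH.
Qed.

(** Normalization changes nothing here, because the algorithm only produces entries up to 2. *)
Lemma norm_conv G (H : list (fm G)) a c n :
  heq H (normC · (convC · a · c) · S' (S' n))
    (convdigitC · a · c · (convposC · a · c · n) · (convnegC · a · c · n) · n).
Proof.
rewrite norm_SS, conv_SS; apply min_le, convdigit_le.
Qed.

(** Together with [neg_conv] this identifies the internal state p - q of the greedy algorithm with
    the truncation of its own output. *)
Lemma pos_conv G (H : list (fm G)) a c n :
  heq H (posC · (convC · a · c) · n) (convposC · a · c · n).
Proof.
heq_induction (posC · (convC · tm_wk T0 a · tm_wk T0 c) · v0)
  (convposC · tm_wk T0 a · tm_wk T0 c · v0) n.
- now rewrite pos_0, conv_0, convpos_0.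
- now rewrite pos_S, convpos_S, norm_conv, IH.
Qed.

(** With A_m = s_m(x) + s_m(y), the difference l - r is A_(n+3) - 8 s_n(x + y), the quantity that
    decides the next digit. The internal sequences of the conversion no longer appear. *)
Lemma add_digit_cases G (H : list (fm G)) x y n C :
  let m := S' (S' (S' n)) in
  let l := posC · x · m ⊕ posC · y · m ⊕ numeral 8 ⊗ (negC · (x +R y) · n) in
  let r := negC · x · m ⊕ negC · y · m ⊕ numeral 8 ⊗ (posC · (x +R y) · n) in
  let e := normC · (x +R y) · S' (S' n) in
  (forall H', incl H H' -> H' ⊩ S' (S' r) ≤0 l -> heq H' e (numeral 2) -> H' ⊩ C) ->
  (forall H', incl H H' -> H' ⊩ S' (S' l) ≤0 r -> heq H' e zero -> H' ⊩ C) ->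
  (forall H', incl H H' -> H' ⊩ l ≤0 S' r -> H' ⊩ r ≤0 S' l ->
    heq H' e (numeral 1) -> H' ⊩ C) ->
  H ⊩ C.
Proof.
intros m l r e D2 D0 D1.
destruct (add_eq x y) as (a & c & E).
assert (El : forall H', heq H' (a · m ⊕ numeral 8 ⊗ (convnegC · a · c · n)) l)
  by (intros H'; destruct (E H') as (E1 & E2 & E3);
      subst l; rewrite E1, E2, neg_conv; reflexivity).
assert (Er : forall H', heq H' (c · m ⊕ numeral 8 ⊗ (convposC · a · c · n)) r)
  by (intros H'; destruct (E H') as (E1 & E2 & E3);
      subst r; rewrite E1, E3, pos_conv; reflexivity).
assert (Ee : forall H', heq H' (convdigitC · a · c · (convposC · a · c · n)
    · (convnegC · a · c · n) · n) e)
  by (intros H'; destruct (E H') as (E1 & E2 & E3);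
      subst e; rewrite E1, norm_conv; reflexivity).
apply (@convdigit_cases _ _ a c (convposC · a · c · n) (convnegC · a · c · n) n);
  cbv zeta; fold m; intros H' I L; specialize (El H'); specialize (Er H');
  specialize (Ee H'); clearbody l r e.
- intros F; apply (D2 H' I); [linear (L, El, Er)|now rewrite <- Ee].
- intros F; apply (D0 H' I); [linear (L, El, Er)|now rewrite <- Ee].
- intros R F; apply (D1 H' I); [linear (L, El, Er)|linear (R, El, Er)|now rewrite <- Ee].
Qed.

(** For A_2 ≥ 0 the positive part is ⌊(A_2 + 2)/4⌋, which gives the bound at once. For A_2 < 0 the
    positive part is ⌊2/4⌋ = 0, and the remainder bound for ⌊(|A_2| + 2)/4⌋ yields 4 s_0 ≤ A_2 +
    1. *)
Lemma add_0 G (H : list (fm G)) x y :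
  let m := numeral 2 in
  H ⊩ numeral 4 ⊗ (posC · (x +R y) · zero) ⊕ (negC · x · m ⊕ negC · y · m)
    ≤0 posC · x · m ⊕ posC · y · m ⊕ numeral 2
       ⊕ numeral 4 ⊗ (negC · (x +R y) · zero).
Proof.
intros m.
destruct (add_eq x y) as (a & c & E); destruct (E H) as (E1 & Ea & Ec).
pose proof (Ea m) as Ea2; pose proof (Ec m) as Ec2; clear Ea Ec E.
assert (P : heq H (posC · (x +R y) · zero)
  (quotC · ((a · m ∸ c · m) ⊕ numeral 2) · numeral 3))
  by now rewrite E1, pos_conv, convpos_0, convpos0_eq.
assert (N : heq H (negC · (x +R y) · zero)
  (quotC · ((c · m ∸ a · m) ⊕ numeral 2) · numeral 3))
  by now rewrite E1, neg_conv, convneg_0, convneg0_eq.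
clear E1.
set (u := a · m ∸ c · m) in *; set (v := c · m ∸ a · m) in *.
pose proof (pr_andE1 (quot3 H (u ⊕ numeral 2))) as Q1.
pose proof (pr_andE2 (quot3 H (v ⊕ numeral 2))) as Q2.
apply (@le_cases _ _ (c · m) (a · m)); intros H' I D; lift I.
- pose proof (le_elim D) as F; fold u in F.
  linear (D, F, P, N, Ea2, Ec2, Q1).
- assert (D' : H' ⊩ a · m ≤0 c · m) by linear D.
  pose proof (le_elim D') as F; fold v in F.
  apply heq_of_eq in D'; fold u in D'.
  assert (Z : heq H' (posC · (x +R y) · zero) zero).
  { rewrite P; apply quot_small; linear D'. }
  linear (F, Z, N, Ea2, Ec2, Q2).
Qed.

(** 4 s_n(x + y) ≤ s_(n+2)(x) + s_(n+2)(y) + 2, with each s_n = [posC] - [negC].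
    Only the step with digit -1 uses the induction hypothesis. *)
Lemma add_le G (H : list (fm G)) x y n :
  let m := S' (S' n) in
  H ⊩ numeral 4 ⊗ (posC · (x +R y) · n) ⊕ (negC · x · m ⊕ negC · y · m)
    ≤0 posC · x · m ⊕ posC · y · m ⊕ numeral 2
       ⊕ numeral 4 ⊗ (negC · (x +R y) · n).
Proof.
intros m; subst m.
fm_induction (let x := tm_wk T0 x in let y := tm_wk T0 y in
  let n := v0 in let m := S' (S' v0) in
  numeral 4 ⊗ (posC · (x +R y) · n) ⊕ (negC · x · m ⊕ negC · y · m)
    ≤0 posC · x · m ⊕ posC · y · m ⊕ numeral 2
       ⊕ numeral 4 ⊗ (negC · (x +R y) · n)) n.
- apply add_0.
- revert IH; generalize (tm_wk T0 x) (tm_wk T0 y); clear; intros x y IH.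
  pose proof (pos_S H' (x +R y) v0) as P.
  pose proof (neg_S H' (x +R y) v0) as N.
  pose proof (pos_S H' x (S' (S' v0))) as Px.
  pose proof (neg_S H' x (S' (S' v0))) as Nx.
  pose proof (pos_S H' y (S' (S' v0))) as Py.
  pose proof (neg_S H' y (S' (S' v0))) as Ny.
  apply (@add_digit_cases _ _ x y v0); cbv zeta; intros H'' I D; lift I.
  + intros E; linear (P, N, D, E).
  (* Here 4 s_(n+1) = 8 s_n - 4, and the induction hypothesis gives 8 s_n - 4 ≤ 2 A_(n+2). The next
     digits of x and y are at least -1 each, so 2 A_(n+2) ≤ A_(n+3) + 2: the constant 2 reproduces
     itself. *)
  + intros E; linear (P, N, Px, Nx, Py, Ny, IH, D, E).
  + intros D' E; linear (P, N, D', E).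
Qed.

(** * Nonnegativity of the distance *)

Lemma leR_elim G (H : list (fm G)) x y n : H ⊩ x ≤R y -> H ⊩ le_at x y n.
Proof.
intros D; apply (pr_allE n) in D; revert D.
unfold fm_inst, le_at; cbn [fm_sub]; change (fun _ v => Var v) with (@ids G).
sub_simpl; exact (fun D => D).
Qed.

Lemma eqR_elim G (H : list (fm G)) x y n :
  H ⊩ x =R y -> H ⊩ le_at x y n ∧ le_at y x n.
Proof.
intros D; apply (pr_allE n) in D; revert D.
unfold fm_inst, le_at; cbn [fm_sub]; change (fun _ v => Var v) with (@ids G).
sub_simpl; exact (fun D => D).
Qed.

Lemma zero_approx G (H : list (fm G)) n :
  heq H (posC · (natRC · zero) · n) (negC · (natRC · zero) · n).
Proof.
heq_induction (posC · (natRC · zero) · v0 : tm (T0 :: G) T0)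
  (negC · (natRC · zero) · v0 : tm (T0 :: G) T0) n.
- rewrite pos_0, neg_0, nat_0; change (numeral 1) with (@S' G zero).
  now rewrite nat_S, sg_0.
- rewrite pos_S, neg_S, IH, norm_SS, nat_S, sg_S.
  assert (D : H' ⊩ numeral 1 ≤0 numeral 2) by linear (plus_0 H' zero).
  rewrite (min_le D); linear (plus_0 H' zero).
Qed.

(** For d = d(x, y), the triangle inequality d(x, x) ≤ d(x, y) + d(y, x) yields
    s_(n+3)(d) ≥ -10, whereas s_n(d) ≤ -3 would imply s_(n+3)(d) ≤ -17. *)
Lemma dist_ge0 G (H : list (fm G)) x y n :
  H ⊩ le_at (natRC · zero) (dist x y) n.
Proof.
(* Three digits beyond n are used: after two, s_n(d) ≤ -3 gives only s_(n+2)(d) ≤ -9, which is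
   compatible with a lower bound of -10. *)
set (m := S' (S' (S' n))).
assert (R : H ⊩ le_at (natRC · zero) (dist x x) (S' n)).
{ apply (@pr_andE2 _ _ _ (le_at (dist x x) (natRC · zero) (S' n))), eqR_elim.
  apply pr_axiom, ax_TM, ax_dist_refl. }
assert (S : H ⊩ le_at (dist y x) (dist x y) m).
{ apply (@pr_andE2 _ _ _ (le_at (dist x y) (dist y x) m)), eqR_elim.
  apply pr_axiom, ax_TM, ax_dist_sym. }
assert (T : H ⊩ le_at (dist x x) (dist x y +R dist y x) (S' n))
  by apply leR_elim, pr_axiom, ax_TM, ax_dist_triangle.
pose proof (add_le H (dist x y) (dist y x) (S' n)) as A; cbv zeta in A; fold m in A.
unfold le_at in *.
pose proof (zero_approx H n) as Z; pose proof (zero_approx H (S' n)) as Z'.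
(* The tolerances 2 in [R] and [T] give s_(n+1) ≥ -4 for the sum, so s_m(d(x, y)) + s_m(d(y, x)) ≥
   -18 by [A]. Symmetry costs another 2, and 2 s_m(d(x, y)) ≥ -20 remains. *)
assert (B : H ⊩ negC · dist x y · m ≤0 posC · dist x y · m ⊕ numeral 10)
  by linear (R, S, T, A, Z').
subst m; clear R S T A Z'; generalize dependent (dist x y); intros g B.
pose proof (norm_digit H g n) as D1.
pose proof (norm_digit H g (S' n)) as D2.
pose proof (norm_digit H g (S' (S' n))) as D3.
pose proof (pos_S H g n) as P1; pose proof (neg_S H g n) as N1.
pose proof (pos_S H g (S' n)) as P2; pose proof (neg_S H g (S' n)) as N2.
pose proof (pos_S H g (S' (S' n))) as P3.
pose proof (neg_S H g (S' (S' n))) as N3.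
linear (Z, B, D1, D2, D3, P1, N1, P2, N2, P3, N3).
Qed.

(** * Closeness to zero from the bound 1/(2^n + 1) *)

Lemma pow2_plus G (H : list (fm G)) m n : H ⊩ pow2C · m ≤0 pow2C · (m ⊕ n).
Proof.
fm_induction (pow2C · tm_wk T0 m ≤0 pow2C · (tm_wk T0 m ⊕ v0)) n.
- apply le_heq; now rewrite plus_0.
- assert (E : heq H' (pow2C · (tm_wk T0 m ⊕ S' v0))
    (pow2C · (tm_wk T0 m ⊕ v0) ⊕ pow2C · (tm_wk T0 m ⊕ v0)))
    by now rewrite plus_S, pow2_S.
  linear (E, IH).
Qed.

Lemma pow2_mono G (H : list (fm G)) m n :
  H ⊩ m ≤0 n -> H ⊩ pow2C · m ≤0 pow2C · n.
Proof.
intros D%le_elim.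
refine (le_congr _ _ (pow2_plus H m (n ∸ m))); [reflexivity|now rewrite <- D].
Qed.

(** The first [n] digits of 1/(k+1) vanish if 2^n ≤ k. *)
Lemma inv_digits G (H : list (fm G)) k n :
  H ⊩ pow2C · n ≤0 k -> heq H (posC · (invRC · k) · n) (negC · (invRC · k) · n).
Proof.
intros D; apply heq_of_eq, (pr_impE (A := pow2C · n ≤0 k)); [|exact D].
fm_induction (pow2C · v0 ≤0 tm_wk T0 k ⟶
  posC · (invRC · tm_wk T0 k) · v0 =0 negC · (invRC · tm_wk T0 k) · v0) n.
- apply pr_impI; set (K := (pow2C · zero ≤0 k) :: H).
  assert (F : K ⊩ numeral 1 ≤0 k)
    by (refine (le_congr (pow2_0 K) _ (pr_head _ _)); reflexivity).
  apply eq_of_heq.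
  now rewrite pos_0, neg_0, inv_0, inv_1, (quot_small F).
- apply pr_impI; generalize dependent (tm_wk T0 k); clear; intros k IH.
  set (K := (pow2C · S' v0 ≤0 k) :: H').
  assert (F : K ⊩ pow2C · S' v0 ≤0 k) by apply pr_head.
  pose proof (pow2_S K v0) as P.
  assert (F' : K ⊩ pow2C · v0 ≤0 k) by linear (F, P).
  pose proof (heq_of_eq (pr_impE (weaken1 _ IH) F')) as E.
  apply eq_of_heq; rewrite pos_S, neg_S, E, norm_SS, inv_SS.
  (* Both 2^(n+1) and 2^n are below k + 1, so both quotients vanish and the entry is 1, which
     encodes the digit 0. *)
  rewrite (quot_small F), (quot_small F').
  assert (O : heq K (numeral 1 ⊕ zero ∸ numeral 2 ⊗ zero) (numeral 1))
    by now rewrite mult_0, monus_0, plus_0.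
  rewrite O.
  assert (L : K ⊩ numeral 1 ≤0 numeral 2) by linear (plus_0 K zero).
  rewrite (min_le L); linear (plus_0 K zero).
Qed.

(** For m ≤ n the bound has truncation 0 at precision m, exactly like the real 0, so comparing with
    either is the same at that precision. All m ≤ n are covered because collection only bounds the
    precision. *)
Lemma dist_near_0 G (H : list (fm G)) x y m n :
  H ⊩ dist x y ≤R invRC · (pow2C · n) -> H ⊩ m ≤0 n ->
  H ⊩ le_at (dist x y) (natRC · zero) m ∧ le_at (natRC · zero) (dist x y) m.
Proof.
intros D L; apply pr_andI; [|apply dist_ge0].
apply (leR_elim m) in D.
pose proof (inv_digits (pow2_mono L)) as E.
pose proof (zero_approx H m) as Z.
unfold le_at in *; linear (D, E, Z).
Qed.

(** * Collection over X *)

(** From here on all contexts are concrete, and conversion computes the renamings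
    and substitutions. *)
Transparent lam S' zero numeral rec plusC multC predC monusC minC sgC quotC
  pow2C normC posC negC convdigitC convpos0C convneg0C convnegC convposC convC
  addRC natRC invRC.

Notation v6 := (Var (vs (vs (vs (vs (vs (vs vz))))))).
Notation v7 := (Var (vs (vs (vs (vs (vs (vs (vs vz)))))))).
Notation v8 := (Var (vs (vs (vs (vs (vs (vs (vs (vs vz))))))))).
Notation v9 := (Var (vs (vs (vs (vs (vs (vs (vs (vs (vs vz)))))))))).
Notation v10 := (Var (vs (vs (vs (vs (vs (vs (vs (vs (vs (vs vz))))))))))).

(** This and [below_at] are the matrices of [in_Fix] and of the strict inequality, so quantifying
    the precision gives back the original formulas by conversion. *)
Definition fixed_at {G} (U : tm G (TX ~> TX)) x n : fm G :=
  le_at (dist (U · x) x) (natRC · zero) n ∧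
  le_at (natRC · zero) (dist (U · x) x) n.
Definition below_at {G} (k : tm G T0) (l : tm G T1) (th : tm G (TX ~> T1)) x n :
    fm G := lt_at l (th · x +R invRC · k) n.
Definition witness_at {G} U k l th x n : fm G :=
  @fixed_at G U x n ⟶ below_at k l th x n.

Ltac hyp n :=
  apply pr_hyp;
  lazymatch n with
  | 0 => left; reflexivity
  | 1 => right; left; reflexivity
  | 2 => right; right; left; reflexivity
  | 3 => right; right; right; left; reflexivity
  end.

Theorem proposition4p1 :
  TM_plus ⊢
    (* ∀U ∀u *)
    All (TX ~> TX) (All (T0 ~> TX) (
      asymptotically_fixed v1 v0 ⟶
      (* ∀k ∀λ ∀θ *)
      All T0 (All T1 (All (TX ~> T1) (
        (* context: θ = v0, λ = v1, k = v2, u = v3, U = v4 *)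
        All TX (in_Fix v5 v0 ⟶ v2 <R v1 · v0 +R invRC · v3) ⟶
        Ex T0 (All T0 (v1 ≤0 v0 ⟶ v3 <R v2 · (v5 · v0) +R invRC · v4))))))).
Proof.
apply pr_allI, pr_allI, pr_impI, pr_allI, pr_allI, pr_allI, pr_impI.
cbn [map].
(* Collection is available for Σ-formulas, while [witness_at] is quantifier-free; a vacuous
   quantifier is put in front. Inside it, [v1] is the precision and [v2] is the point x. *)
set (W := Ex T0 (witness_at v7 v5 v4 v3 v2 v1)
  : fm [T0; TX; TX ~> T1; T1; T0; T0 ~> TX; TX ~> TX]).
assert (SW : Sigma_fm W).
{ exists (witness_at v7 v5 v4 v3 v2 v1); split; [|reflexivity].
  repeat constructor. }
match goal with |- proves _ ?H _ => assert (C : H ⊩ All TX (Ex T0 W)) end.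
(* Suppose that x has no witness. Any precision at which x does not look fixed would be one
   vacuously, so x is a fixed point; the precision that verifies the strict inequality is then a
   witness after all. *)
{ apply pr_allI, pr_raa; cbn [map].
  match goal with |- proves _ ?H _ =>
    assert (Fix : H ⊩ All T0 (fixed_at v6 v1 v0)) end.
  { apply pr_allI, pr_raa; cbn [map].
    refine (@pr_impE _ _ _ (Ex T0 (Ex T0 (witness_at v8 v6 v5 v4 v3 v1))) _ _ _).
    - hyp 1.
    (* [zero] is an arbitrary value for the vacuous variable. *)
    - apply (@pr_exI _ _ _ _ _ v0), (@pr_exI _ _ _ _ _ zero), pr_impI, pr_exfalso.
      refine (@pr_impE _ _ _ (fixed_at v6 v1 v0) _ _ _).
      + hyp 1.
      + hyp 0. }
  refine (@pr_exE _ _ _ _ (below_at v4 v3 v2 v1 v0) _ _ _).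
  - refine (@pr_impE _ _ _ (in_Fix v5 v0) _ _ Fix).
    refine (@pr_allE _ _ _ TX (in_Fix v6 v0 ⟶ v3 <R v2 · v0 +R invRC · v4) v0 _).
    hyp 1.
  - cbn [map].
    refine (@pr_impE _ _ _ (Ex T0 (Ex T0 (witness_at v8 v6 v5 v4 v3 v1))) _ _ _).
    + hyp 1.
    + apply (@pr_exI _ _ _ _ _ v0), (@pr_exI _ _ _ _ _ zero), pr_impI.
      hyp 1. }
pose proof (pr_impE (pr_axiom TM_plus _ _ (ax_collection_X SW)) C) as K; clear C.
refine (pr_exE _ K _); clear K SW; cbn [map].
(* context: N, θ, λ, k, u, U *)
refine (@pr_exE _ _ _ T0 (All T0 (v1 ≤0 v0 ⟶
  dist (v7 · (v6 · v0)) (v6 · v0) ≤R invRC · (pow2C · v2))) _ _ _).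
(* The limit hypothesis is used at r = 2^N, with N the bound supplied by collection; the resulting
   threshold is the one claimed. *)
- refine (@pr_allE _ _ _ T0 (Ex T0 (All T0 (v1 ≤0 v0 ⟶
    dist (v8 · (v7 · v0)) (v7 · v0) ≤R invRC · v2))) (pow2C · v0) _).
  hyp 2.
- cbn [map].
  apply (@pr_exI _ _ _ _ _ v0), pr_allI, pr_impI; cbn [map].
  (* context: m, n0, N, θ, λ, k, u, U *)
  refine (@pr_exE _ _ _ T0 (v0 ≤0 v3 ∧
    Ex T0 (witness_at v9 v7 v6 v5 (v8 · v2) v1)) _ _ _).
  (* The collected statement is instantiated at the term u_m itself. *)
  + refine (@pr_allE _ _ _ TX (ExLe v3 (Ex T0
      (witness_at v10 v8 v7 v6 v2 v1))) (v6 · v0) _).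
    hyp 2.
  + cbn [map].
    refine (@pr_exE _ _ _ T0 (witness_at v9 v7 v6 v5 (v8 · v2) v1) _ _ _).
    * refine (@pr_andE2 _ _ _ (v0 ≤0 v3) _ _).
      hyp 0.
    * cbn [map].
      (* context: j, n, m, n0, N, θ, λ, k, u, U, where j is the dummy variable
         that makes the collected formula a Σ-formula *)
      refine (@pr_exI _ _ _ _ _ v1 _).
      refine (@pr_impE _ _ _ (fixed_at v9 (v8 · v2) v1) _ _ _).
      -- hyp 0.
      -- apply (@dist_near_0 _ _ _ _ _ v4).
         ++ refine (@pr_impE _ _ _ (v3 ≤0 v2) _ _ _); [|hyp 2].
            refine (@pr_allE _ _ _ T0 (v4 ≤0 v0 ⟶
              dist (v10 · (v9 · v0)) (v9 · v0) ≤R invRC · (pow2C · v5)) v2 _).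
            hyp 3.
         ++ refine (@pr_andE1 _ _ _ _ (Ex T0
              (witness_at v10 v8 v7 v6 (v9 · v3) v2)) _).
            hyp 1.
Qed.
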